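(* Consider the multi-view model with independent latent factors, and the procedure ''multi-view ECA'' (both described in the context), with output $\widehat O_3=\widehat O_3(\theta)$ on input $\theta\in\mathbb{R}^k$ and the exact moments $\mathrm{Pairs}_{v,v'}$, $\mathrm{Triples}_{132}(\cdot)$. Then: (1) (No false positives) For all $\theta\in\mathbb{R}^k$, the procedure returns a subset of the columns of $O_3$ in a canonical form; that is, there are signs $s_1,\dots,s_k\in\{-1,1\}$ such that $\widehat O_3\subseteq\{s_1\sigma_1O_3e_1,\dots,s_k\sigma_kO_3e_k\}$, where $O_3e_i$ is the $i$-th column of $O_3$. (2) (Exact recovery) Assume $\gamma_i\ne0$ for each $i\in\{1,\dots,k\}$, and let $\theta$ be a random vector uniformly distributed on the unit sphere $\mathcal{S}^{k-1}\subset\mathbb{R}^k$. Then, with probability $1$, the procedure returns all columns of $O_3$ in a canonical form; that is, there are signs $s_i\in\{-1,1\}$ such that $\widehat O_3=\{s_1\sigma_1O_3e_1,\dots,s_k\sigma_kO_3e_k\}$.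
   Context: Model. $h=(h_1,\dots,h_k)^\top\in\mathbb{R}^k$ is a random vector with mutually independent coordinates; $\sigma_i^2:=\mathbb{E}[(h_i-\mathbb{E}[h_i])^2]>0$ (with $\sigma_i>0$), $\mu_{i,3}:=\mathbb{E}[(h_i-\mathbb{E}[h_i])^3]$, $\gamma_i:=\mu_{i,3}/\sigma_i^3$. The observed vectors $x_v\in\mathbb{R}^{d_v}$, $d_v\ge k$, $v=1,2,3$, are conditionally independent given $h$, and $\mathbb{E}[x_v\mid h]=O_vh$ where $O_v\in\mathbb{R}^{d_v\times k}$ has full rank $k$ for each $v$. All moments that appear are assumed to exist and be finite. Moments. $\mu_v:=\mathbb{E}[x_v]$; for distinct $v,v'\in\{1,2,3\}$, $\mathrm{Pairs}_{v,v'}:=\mathbb{E}[(x_v-\mu_v)(x_{v'}-\mu_{v'})^\top]$ (also written $\mathrm{Pairs}_{vv'}$); for $\eta\in\mathbb{R}^{d_3}$, $\mathrm{Triples}_{132}(\eta):=\mathbb{E}[(x_1-\mu_1)(x_2-\mu_2)^\top\langle\eta,x_3-\mu_3\rangle]\in\mathbb{R}^{d_1\times d_2}$. Canonical form. The $O_v$ are in canonical form if $\sigma_i^2=1$ for each $i$; replacing $O_v$ by $O_v\,\mathrm{diag}(\sigma_1,\dots,\sigma_k)$ (and rescaling $h$) achieves this, and canonical form is only specified up to the sign of each column. Pseudo-inverse. For a matrix $A$ with linearly independent columns, $A^+=(A^\top A)^{-1}A^\top$. Procedure ''multi-view ECA'' (input $\theta\in\mathbb{R}^k$ and the moments). Step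 1: choose any $A\in\mathbb{R}^{k\times d_1}$, $B\in\mathbb{R}^{k\times d_2}$ such that $A\,\mathrm{Pairs}_{12}B^\top$ is invertible, and set $\widetilde{\mathrm{Pairs}}_{12}:=A\,\mathrm{Pairs}_{12}B^\top$, $\widetilde{\mathrm{Pairs}}_{31}:=\mathrm{Pairs}_{31}A^\top$, $\widetilde{\mathrm{Pairs}}_{32}:=\mathrm{Pairs}_{32}B^\top$, $\widetilde{\mathrm{Pairs}}_{13}:=\widetilde{\mathrm{Pairs}}_{31}^\top$, $\widetilde{\mathrm{Pairs}}_{23}:=\widetilde{\mathrm{Pairs}}_{32}^\top$, $\widetilde{\mathrm{Triples}}_{132}(\eta):=A\,\mathrm{Triples}_{132}(\eta)B^\top$. Step 2: set $$\mathrm{Pairs}_3:=\widetilde{\mathrm{Pairs}}_{31}(\widetilde{\mathrm{Pairs}}_{12}^\top)^{-1}\widetilde{\mathrm{Pairs}}_{23},\qquad \mathrm{Triples}_3(\eta):=\widetilde{\mathrm{Pairs}}_{32}(\widetilde{\mathrm{Pairs}}_{12})^{-1}\widetilde{\mathrm{Triples}}_{132}(\eta)(\widetilde{\mathrm{Pairs}}_{12})^{-1}\widetilde{\mathrm{Pairs}}_{13}.$$ Step 3: (i) choose any $U\in\mathbb{R}^{d_3\times k}$ with $\mathrm{Range}(U)=\mathrm{Range}(\mathrm{Pairs}_3)$; (ii) choose any $V\in\mathbb{R}^{k\times k}$ such that $V^\top(U^\top\mathrm{Pairs}_3U)V$ is the $k\times k$ identity, and set $W=UV$; (iii) let $\Lambda$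 be the set of (unit-norm) left singular vectors of $W^\top\mathrm{Triples}_3(W\theta)W$ whose singular values are unique (of multiplicity one), one vector, determined up to sign, per such singular value; (iv) return $\widehat O_3=\{(W^+)^\top\lambda:\lambda\in\Lambda\}$. *)

(* Defs.v *)
From HB Require Import structures.
From mathcomp Require Import all_boot all_order all_algebra.
From mathcomp Require Import all_classical all_reals all_analysis.

Set Implicit Arguments.
Unset Strict Implicit.
Unset Printing Implicit Defensive.

Import Order.TTheory GRing.Theory Num.Theory.
Import numFieldNormedType.Exports.

Local Open Scope classical_set_scope.
Local Open Scope ring_scope.

(* A random vector in R^n is a map into column vectors whose coordinates are
   measurable; its sigma-algebra is generated by the coordinates. *)
Definition random_vector d (T : measurableType d) (R : realType) n
    (X : T -> 'cV[R]_n) : Prop :=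
  forall i, measurable_fun [set: T] (fun w => X w i 0).

Definition sigma_of d (T : measurableType d) (R : realType) n
    (X : T -> 'cV[R]_n) : set (set T) :=
  g_sigma_preimage (fun (i : 'I_n) (w : T) => X w i 0).

(* The Borel sets of R^n, as the product sigma-algebra. *)
Definition borel_cV (R : realType) n : set (set 'cV[R]_n) :=
  g_sigma_preimage (fun (i : 'I_n) (y : 'cV[R]_n) => y i 0).

Definition expect_mx d (T : measurableType d) (R : realType)
    (P : probability T R) m n (X : T -> 'M[R]_(m, n)) : 'M[R]_(m, n) :=
  \matrix_(i, j) fine 'E_P[fun w => X w i j].

(* [fine] sends infinite expectations to 0, so [expect_mx] is meaningful only
   together with this predicate. *)
Definition integrable_mx d (T : measurableType d) (R : realType)
    (P : probability T R) m n (X : T -> 'M[R]_(m, n)) : Prop :=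
  forall i j, P.-integrable [set: T] (fun w => (X w i j)%:E).

Definition centered d (T : measurableType d) (R : realType)
    (P : probability T R) n (X : T -> 'cV[R]_n) (w : T) : 'cV[R]_n :=
  X w - expect_mx P X.

Definition central_moment d (T : measurableType d) (R : realType)
    (P : probability T R) n (X : T -> 'cV[R]_n) (i : 'I_n) (p : nat) : R :=
  fine 'E_P[fun w => centered P X w i 0 ^+ p].

Definition mutually_independent d (T : measurableType d) (R : realType)
    (P : probability T R) n (X : T -> 'cV[R]_n) : Prop :=
  forall (J : {set 'I_n}) (B : 'I_n -> set R),
    (forall i, measurable (B i)) ->
    P (\bigcap_(i in [set` J]) [set w | B i (X w i 0)]) =
    (\prod_(i in J) P [set w | B i (X w i 0%R)])%E.

(* Y is a version of the conditional expectation E[X | G]. *)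
Definition is_cond_expectation d (T : measurableType d) (R : realType)
    (P : probability T R) (G : set (set T)) (X Y : T -> R) : Prop :=
  [/\ P.-integrable [set: T] (EFin \o X),
      P.-integrable [set: T] (EFin \o Y),
      preimage_set_system [set: T] Y measurable `<=` G &
      forall A, G A ->
        (\int[P]_(w in A) (X w)%:E = \int[P]_(w in A) (Y w)%:E)%E].

(* The random vectors x_v are conditionally independent given G: the
   conditional probability of an intersection of events, one in each
   sigma(x_v), is almost surely the product of the conditional probabilities.
   Taking some of the events equal to T gives the same for subfamilies. *)
Definition conditionally_independent d (T : measurableType d) (R : realType)
    (P : probability T R) (G : set (set T)) m (n : 'I_m -> nat)
    (x : forall v : 'I_m, T -> 'cV[R]_(n v)) : Prop :=
  forall A : 'I_m -> set T, (forall v, sigma_of (x v) (A v)) ->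
  exists Y : 'I_m -> T -> R,
    (forall v, is_cond_expectation P G \1_(A v) (Y v)) /\
    is_cond_expectation P G \1_(\bigcap_v A v) (fun w => \prod_v Y v w).

(* Uniform distribution on the unit sphere: the probability carried by the
   sphere that is invariant under the orthogonal group. *)
Definition uniform_on_sphere d (T : measurableType d) (R : realType)
    (P : probability T R) n (X : T -> 'cV[R]_n) : Prop :=
  [/\ random_vector X,
      {ae P, forall w, (X w)^T *m X w = 1%:M} &
      forall Q : 'M[R]_n, Q^T *m Q = 1%:M ->
      forall B, borel_cV B ->
        P [set w | B (Q *m X w)] = P [set w | B (X w)]].

Definition view1 : 'I_3 := @Ordinal 3 0 isT.
Definition view2 : 'I_3 := @Ordinal 3 1 isT.
Definition view3 : 'I_3 := @Ordinal 3 2 isT.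

Section Model.
Context d (T : measurableType d) (R : realType) (P : probability T R).
Context (k : nat) (h : T -> 'cV[R]_k).
Context (dim : 'I_3 -> nat) (x : forall v : 'I_3, T -> 'cV[R]_(dim v)).
Context (O : forall v : 'I_3, 'M[R]_(dim v, k)).

(* sigma_i *)
Definition std_dev (i : 'I_k) : R := Num.sqrt (central_moment P h i 2).

(* gamma_i *)
Definition skewness (i : 'I_k) : R :=
  central_moment P h i 3 / std_dev i ^+ 3.

Definition pairs_rv (v v' : 'I_3) (w : T) : 'M[R]_(dim v, dim v') :=
  centered P (x v) w *m (centered P (x v') w)^T.

Definition triples_rv (eta : 'cV[R]_(dim view3)) (w : T)
    : 'M[R]_(dim view1, dim view2) :=
  (eta^T *m centered P (x view3) w) 0 0 *: pairs_rv view1 view2 w.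

Definition Pairs (v v' : 'I_3) : 'M[R]_(dim v, dim v') :=
  expect_mx P (pairs_rv v v').

Definition Triples132 (eta : 'cV[R]_(dim view3))
    : 'M[R]_(dim view1, dim view2) :=
  expect_mx P (triples_rv eta).

Record multiview_model : Prop := MultiviewModel {
  factors_rv : random_vector h;
  views_rv : forall v, random_vector (x v);
  factors_indep : mutually_independent P h;
  factors_int : forall i, P.-integrable [set: T] (fun w => (h w i 0)%:E);
  factors_int2 : forall i,
    P.-integrable [set: T] (fun w => (centered P h w i 0 ^+ 2)%:E);
  factors_int3 : forall i,
    P.-integrable [set: T] (fun w => (centered P h w i 0 ^+ 3)%:E);
  factors_var_gt0 : forall i, 0 < central_moment P h i 2;
  views_cond_indep : conditionally_independent P (sigma_of h) x;
  views_dim : forall v, (k <= dim v)%N;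
  views_rank : forall v, \rank (O v) = k;
  views_cond_mean : forall v (a : 'I_(dim v)),
    is_cond_expectation P (sigma_of h)
      (fun w => x v w a 0) (fun w => (O v *m h w) a 0);
  views_int : forall v, integrable_mx P (x v);
  pairs_int : forall v v', v != v' -> integrable_mx P (pairs_rv v v');
  triples_int : forall eta, integrable_mx P (triples_rv eta)
}.

(* {s_1 sigma_1 O_3 e_1, ..., s_k sigma_k O_3 e_k} *)
Definition canonical_columns (s : 'I_k -> R) : set 'cV[R]_(dim view3) :=
  [set s i *: (std_dev i *: col i (O view3)) | i in [set: 'I_k]].

End Model.

Definition signs (R : realType) k (s : 'I_k -> R) : Prop :=
  forall i, s i = -1 \/ s i = 1.

(* The pseudo-inverse of a matrix with linearly independent columns. *)
Definition pinv (R : realType) m n (A : 'M[R]_(m, n)) : 'M[R]_(n, m) :=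
  invmx (A^T *m A) *m A^T.

Definition is_svd (R : realType) n (M L : 'M[R]_n) (s : 'rV[R]_n)
    (Q : 'M[R]_n) : Prop :=
  [/\ L^T *m L = 1%:M, Q^T *m Q = 1%:M, forall i, 0 <= s 0 i &
      M = L *m diag_mx s *m Q^T].

(* u is a (unit) left singular vector of M for the singular value t, and t has
   multiplicity one. *)
Definition simple_left_singular (R : realType) n (M : 'M[R]_n) (t : R)
    (u : 'cV[R]_n) : Prop :=
  exists L s Q i,
    [/\ is_svd M L s Q, u = col i L, s 0 i = t &
        forall j, s 0 j = t -> j = i].

(* Each simple left singular vector is determined up to sign; Lam contains
   exactly one of the two for each singular value of multiplicity one. *)
Definition simple_left_singular_set (R : realType) n (M : 'M[R]_n)
    (Lam : set 'cV[R]_n) : Prop :=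
  (forall u, Lam u -> exists t, simple_left_singular M t u) /\
  (forall t, (exists u, simple_left_singular M t u) ->
     exists! u, Lam u /\ simple_left_singular M t u).

Section MultiviewECA.
Context (R : realType) (k d1 d2 d3 : nat).
Context (Pairs12 : 'M[R]_(d1, d2)) (Pairs31 : 'M[R]_(d3, d1))
        (Pairs32 : 'M[R]_(d3, d2)) (Triples : 'cV[R]_d3 -> 'M[R]_(d1, d2)).
Context (A : 'M[R]_(k, d1)) (B : 'M[R]_(k, d2)).
Context (U : 'M[R]_(d3, k)) (V : 'M[R]_k).

Definition tPairs12 : 'M[R]_k := A *m Pairs12 *m B^T.
Definition tPairs31 : 'M[R]_(d3, k) := Pairs31 *m A^T.
Definition tPairs32 : 'M[R]_(d3, k) := Pairs32 *m B^T.
Definition tPairs13 : 'M[R]_(k, d3) := tPairs31^T.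
Definition tPairs23 : 'M[R]_(k, d3) := tPairs32^T.
Definition tTriples132 (eta : 'cV[R]_d3) : 'M[R]_k := A *m Triples eta *m B^T.

Definition Pairs3 : 'M[R]_d3 := tPairs31 *m invmx tPairs12^T *m tPairs23.

Definition Triples3 (eta : 'cV[R]_d3) : 'M[R]_d3 :=
  tPairs32 *m invmx tPairs12 *m tTriples132 eta *m invmx tPairs12 *m tPairs13.

(* The constraints on the choices made in the procedure before theta is used. *)
Definition ECA_choices : Prop :=
  [/\ tPairs12 \in unitmx,
      range (fun y : 'cV[R]_k => U *m y) =
        range (fun y : 'cV[R]_d3 => Pairs3 *m y) &
      V^T *m (U^T *m Pairs3 *m U) *m V = 1%:M].

(* Ohat is a possible output on input theta; the only freedom left is the sign
   of each singular vector. *)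
Definition ECA_output (theta : 'cV[R]_k) (Ohat : set 'cV[R]_d3) : Prop :=
  let W := U *m V in
  exists2 Lam,
    simple_left_singular_set (W^T *m Triples3 (W *m theta) *m W) Lam &
    Ohat = [set (pinv W)^T *m l | l in Lam].

End MultiviewECA.

(* Main.v *)
(* Conditional independence upgrades E[x_v | h] = O_v h to
   E[x_v | h, x_u (u <> v)] = O_v h, so the views can be replaced by their
   conditional means one at a time inside the cross moments. By independence of
   the factors, Pairs_vv' = C_v C_v'^T and Triples_132(eta) =
   C_1 diag(gamma_i <eta, C_3 e_i>) C_2^T, where C_v = O_v diag(sigma).
   Then Pairs_3 = C_3 C_3^T, hence M = W^T C_3 is orthogonal, the matrix of
   step 3 is M diag(gamma_i <theta, M e_i>) M^T and (W^+)^T M = C_3. The simple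
   left singular vectors of M diag(d) M^T are the +- M e_a for which |d_a| is
   attained only at a. Finally |d_i| = |d_j| with i <> j confines theta to two
   hyperplanes, each of probability zero. *)

Require Import Defs.
From HB Require Import structures.
From mathcomp Require Import all_boot all_order all_algebra.
From mathcomp Require Import all_classical all_reals all_analysis.
From mathcomp Require Import measurable_realfun.
From mathcomp Require Import ring lra.

Set Implicit Arguments.
Unset Strict Implicit.
Unset Printing Implicit Defensive.

Import Order.TTheory GRing.Theory Num.Theory.
Import numFieldNormedType.Exports.

Local Open Scope classical_set_scope.
Local Open Scope ring_scope.

(** * Integrals against functions measurable for a sub-sigma-algebra *)

Section SubSigmaAlgebra.
Context d (T : measurableType d) (R : realType) (P : probability T R).

Local Notation intg f := (P.-integrable [set: T] (EFin \o f)).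
Local Notation Ex f := (\int[P]_w f w).

(** The model assumes the cross products of distinct views integrable, but no second moment of a
    single view. The product of one view with the conditional mean of another is thus not integrable
    for free: each replacement of a view by its conditional mean must also deliver the integrability
    that the next replacement consumes. Conditional independence speaks of events, through versions
    of conditional probabilities chosen anew for each family of events, so versions coming from
    different families have to be compared almost everywhere before they can be multiplied.
    Conditional expectation and independence of the factors both rest on one fact: a function whose
    integral vanishes on every event of a sub-sigma-algebra is orthogonal to the functions
    measurable for it, as soon as the product is integrable. No joint law is formed. The uniform law
    on the sphere is given by invariance, without a density. Hyperplanes are null by counting:
    infinitely many equiprobable hyperplanes cover each point a bounded number of times. *)

Lemma integrable_mul_indic (f : T -> R) E : measurable E ->
  intg f -> intg (fun w => f w * \1_E w).
Proof.
move=> mE fi; apply: le_integrable (fi) => //.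
  apply/measurable_EFinP/measurable_funM; last exact: measurable_indic.
  by apply/measurable_EFinP; exact: measurable_int fi.
move=> w _ /=; rewrite lee_fin normrM indicE.
by rewrite ler_piMr// ger0_norm// lern1 leq_b1.
Qed.

Lemma Rintegral_indic (f : T -> R) E :
  Ex (fun w => f w * \1_E w) = \int[P]_(w in E) f w.
Proof. by rewrite [RHS]Rintegral_mkcond patch_indic. Qed.

Lemma integrable_eq (f g : T -> R) : f =1 g -> intg f -> intg g.
Proof. by move=> /funext ->. Qed.

Lemma integrable_norm_le (f g : T -> R) : measurable_fun setT f ->
  (forall w, `|f w| <= g w) -> intg g -> intg f.
Proof.
move=> mf fg; apply: le_integrable => //; first exact/measurable_EFinP.
by move=> w _ /=; rewrite lee_fin (le_trans (fg w))// ler_norm.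
Qed.

Lemma eq_Rint_ae (f g : T -> R) : intg f -> measurable_fun setT g ->
  {ae P, forall w, f w = g w} -> intg g /\ Ex f = Ex g.
Proof.
move=> fi mg fg.
have mf : measurable_fun setT (EFin \o f) by exact: measurable_int fi.
have mg' : measurable_fun setT (EFin \o g) by apply/measurable_EFinP.
(* Used with [u] the norm for integrability and with [u] the identity for the value. *)
have E (u : R -> R) : measurable_fun setT u ->
    (\int[P]_w (u (f w))%:E = \int[P]_w (u (g w))%:E)%E.
  move=> mu; apply: ae_eq_integral => //.
  - by apply/measurable_EFinP/(measurableT_comp mu); exact/measurable_EFinP.
  - by apply/measurable_EFinP/(measurableT_comp mu).
  - by apply: filterS fg => w -> _.
split; last by congr fine; apply: (E id); exact: measurable_id.
apply/integrableP; split => //.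
have /integrableP[_] := fi.
by have /= -> := E (fun x => `|x|) (@normr_measurable R setT).
Qed.

Section span.
Variables (G : set (set T)).
Hypothesis subG : <<s G>> `<=` measurable.
Let S : measurableType _ := g_sigma_algebraType G.

Lemma sub_measurable_fun (z : T -> R) :
  measurable_fun [set: S] z -> measurable_fun [set: T] z.
Proof. by move=> mz _ B mB; apply: subG; exact: mz. Qed.

(** Integrability is carried along with the vanishing integral: [Rintegral] sends an infinite
    integral to 0, so the equation alone would not be stable under sums. *)
Let orth (D : T -> R) (g : T -> R) :=
  intg (fun w => D w * g w) /\ Ex (fun w => D w * g w) = 0.

Let orth_indic (D : T -> R) E : intg D -> measurable E ->
  \int[P]_(w in E) D w = 0 -> orth D \1_E.
Proof.
move=> Di mE D0; split; first exact: integrable_mul_indic.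
by rewrite Rintegral_indic.
Qed.

Let orthZ D g (c : R) : orth D g -> orth D (fun w => c * g w).
Proof.
move=> [gi g0]; rewrite /orth.
have -> : (fun w => D w * (c * g w)) = (fun w => c * (D w * g w)).
  by apply/funext => w; rewrite mulrCA.
split; last by rewrite RintegralZl// g0 mulr0.
have := integrableZl measurableT c gi; exact: eq_integrable.
Qed.

Let orthD D g g' : orth D g -> orth D g' -> orth D (fun w => g w + g' w).
Proof.
move=> [gi g0] [gi' g0'].
rewrite /orth; under eq_fun do rewrite mulrDr.
split; last by rewrite RintegralD// g0 g0' addr0.
exact: (integrableD measurableT gi gi').
Qed.

Let orth_sum D n (g : nat -> T -> R) : (forall k, orth D (g k)) ->
  orth D (fun w => \sum_(k < n) g k w).
Proof.
move=> og; elim: n => [|n IHn].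
  rewrite /orth; under eq_fun do rewrite big_ord0 mulr0.
  split; first exact: integrable0.
  by rewrite Rintegral_cst// mul0r.
under eq_fun do rewrite big_ord_recr.
exact: orthD.
Qed.

Variable D : T -> R.
Hypothesis Di : intg D.
Hypothesis D0 : forall E, <<s G>> E -> \int[P]_(w in E) D w = 0.

Import HBNNSimple.

(** The simple approximations of [z] are built over [S], so their level sets lie in [<<s G>>] and
    each approximation is orthogonal to [D]. Dominated convergence with bound [|D z|] passes to the
    limit. *)
Let orth_ge0 (z : T -> R) : measurable_fun [set: S] z -> (forall w, 0 <= z w) ->
  intg (fun w => D w * z w) -> Ex (fun w => D w * z w) = 0.
Proof.
move=> mz z0 Dzi.
have mz' : measurable_fun [set: S] (EFin \o z) by exact/measurable_EFinP.
pose zn := nnsfun_approx measurableT mz'.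
have zn_orth n : orth D (zn n).
  rewrite /zn nnsfun_approxE /approx.
  have mB : @measurable _ S (@integer_approx _ S R setT (EFin \o z) n).
    exact: emeasurable_fun_c_infty measurableT mz' _.
  have mA k : @measurable _ S (@dyadic_approx _ S R setT (EFin \o z) n k).
    rewrite /dyadic_approx; case: ifPn => // _.
    rewrite (_ : [set _ | _] = z @^-1` [set` dyadic_itv R n k]).
      exact: mz.
    apply/seteqP; split => w /=.
      by rewrite inE => -[r ? [<-]].
    by move=> ?; rewrite inE; exists (z w).
  apply: orthD; last first.
    by apply: orthZ; apply: orth_indic => //; [exact: subG|exact: D0].
  apply: (@orth_sum _ _ (fun k w => k%:R / 2 ^+ n *
    \1_(@dyadic_approx _ S R setT (EFin \o z) n k) w)) => k; apply: orthZ.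
  by apply: orth_indic => //; [exact: subG (mA k)|exact: D0 (mA k)].
have zn_le n w : zn n w <= z w.
  rewrite -lee_fin /zn nnsfun_approxE.
  by apply: (@le_approx _ S R setT (EFin \o z)) => // v _; rewrite lee_fin.
have := @dominated_convergence _ _ _ P setT measurableT
  (fun n w => (D w * zn n w)%:E) (fun w => (D w * z w)%:E)
  (fun w => `|D w * z w|%:E).
case.
- by move=> n; have [/integrableP[]] := zn_orth n.
- exact: measurable_int Dzi.
- apply/aeW => w _; rewrite EFinM.
  under eq_fun do rewrite EFinM.
  apply: cvgeZl => //; by apply: (@cvg_nnsfun_approx _ S R setT measurableT) => // v _ /=; rewrite lee_fin.
- exact: (integrable_norm Dzi).
- apply/aeW => w n _ /=; rewrite lee_fin !normrM ler_wpM2l//.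
  by rewrite !ger0_norm// zn_le.
move=> _ _; have -> : [sequence (\int[P]_x (D x * zn n x)%:E)%E]_n = cst 0%E.
  apply/funext => n /=; have [i e] := zn_orth n.
  by rewrite -[LHS]fineK ?integrable_fin_num//; congr (_%:E).
move=> /cvg_lim -/(_ (@ereal_hausdorff _)); rewrite lim_cst; last exact: ereal_hausdorff.
by rewrite /Rintegral => <-.
Qed.

(** Both parts of [z] are measurable for [S], and their products with [D] are dominated by [|D z|].
    For [D = f - F] this turns equality of integrals over events into [E[f z] = E[F z]]. *)
Lemma Rintegral_mul_sub_measurable (z : T -> R) : measurable_fun [set: S] z ->
  intg (fun w => D w * z w) -> Ex (fun w => D w * z w) = 0.
Proof.
move=> mz Dzi.
have mD : measurable_fun setT D by apply/measurable_EFinP; exact: measurable_int Di.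
have mzp := measurable_funrpos mz; have mzn := measurable_funrneg mz.
have ip : intg (fun w => D w * z^\+ w).
  apply: (integrable_norm_le _ _ (integrable_norm Dzi)).
    by apply: measurable_funM => //; exact: sub_measurable_fun mzp.
  move=> w /=; rewrite !normrM ler_wpM2l// ger0_norm ?funrpos_ge0//.
  by rewrite /funrpos ge_max ler_norm normr_ge0.
have im : intg (fun w => D w * z^\- w).
  apply: (integrable_norm_le _ _ (integrable_norm Dzi)).
    by apply: measurable_funM => //; exact: sub_measurable_fun mzn.
  move=> w /=; rewrite !normrM ler_wpM2l// ger0_norm ?funrneg_ge0//.
  by rewrite /funrneg ge_max -normrN ler_norm normr_ge0.
have -> : (fun w => D w * z w) = (fun w => D w * z^\+ w - D w * z^\- w).
  by apply/funext => w; rewrite -mulrBr -{1}(funrposBneg z).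
by rewrite RintegralB// !orth_ge0 ?subr0// => w; rewrite ?funrpos_ge0 ?funrneg_ge0.
Qed.

End span.

Section PullOut.
Variables (G : set (set T)).
Hypothesis subG : <<s G>> `<=` measurable.
Let S : measurableType _ := g_sigma_algebraType G.

(** Measurability for [S] is asked of [z] alone. The lemma therefore also applies with [f] the
    indicator of an event and [F] its probability, which is how independence enters. *)
Lemma eq_Rintegral_mul_sub (f F z : T -> R) : intg f -> intg F ->
    (forall E, <<s G>> E -> \int[P]_(w in E) f w = \int[P]_(w in E) F w) ->
    measurable_fun [set: S] z ->
    intg (fun w => f w * z w) -> intg (fun w => F w * z w) ->
  Ex (fun w => F w * z w) = Ex (fun w => f w * z w).
Proof.
move=> fi Fi fF mz fzi Fzi; apply/eqP; rewrite eq_sym -subr_eq0; apply/eqP.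
rewrite -RintegralB//; under eq_Rintegral do rewrite -mulrBl.
apply: (Rintegral_mul_sub_measurable subG _ _ mz).
- exact: (integrableB measurableT fi Fi).
- move=> E GE; have mE := subG GE.
  by rewrite RintegralB ?fF ?subrr//; apply: integrableS measurableT _ _ _.
- apply: integrable_eq (integrableB measurableT fzi Fzi) => w /=.
  by rewrite mulrBl.
Qed.

(* For the integrability of [F z], the truncations [zn] of [|z|] satisfy
   [E[|F| zn] = E[F sgn(F) zn] = E[f sgn(F) zn] <= E[|f z|]]. *)
Lemma pull_out (f F z : T -> R) : intg f -> intg F ->
    (forall E, <<s G>> E -> \int[P]_(w in E) f w = \int[P]_(w in E) F w) ->
    measurable_fun [set: S] F -> measurable_fun [set: S] z ->
    intg (fun w => f w * z w) ->
  intg (fun w => F w * z w) /\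
  Ex (fun w => F w * z w) = Ex (fun w => f w * z w).
Proof.
move=> fi Fi fF mF mz fzi.
suff Fzi : intg (fun w => F w * z w).
  by split=> //; exact: eq_Rintegral_mul_sub.
have mFT := sub_measurable_fun subG mF; have mzT := sub_measurable_fun subG mz.
have mfT : measurable_fun setT f by apply/measurable_EFinP; exact: measurable_int fi.
(* The sign of [F], set to 1 where [F] vanishes so that [|u| = 1] everywhere. *)
pose u w : R := 2 * \1_[set w | 0 <= F w] w - 1.
have uF w : F w * u w = `|F w|.
  rewrite /u indicE; have [F0|F0] := leP 0 (F w).
    by rewrite mem_set//= mulr1 -[2]/(1 + 1) addrK mulr1 ger0_norm.
  by rewrite memNset/= ?mulr0 ?sub0r ?mulrN1 ?ltr0_norm//; apply/negP; rewrite -ltNge.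
have u1 w : `|u w| = 1.
  rewrite /u indicE; case: (w \in _) => /=; last by rewrite mulr0 sub0r normrN1.
  by rewrite mulr1 -[2]/(1 + 1) addrK normr1.
have mu : measurable_fun [set: S] u.
  apply: measurable_funB; last exact: measurable_cst.
  apply: measurable_funM; first exact: measurable_cst.
  apply: measurable_indic; rewrite -[X in measurable X]setTI.
  exact: (measurable_fun_le measurableT (measurable_cst _) mF).
pose zn (n : nat) w : R := Order.min `|z w| n%:R.
have zn0 n w : 0 <= zn n w by rewrite /zn le_min normr_ge0 ler0n.
have mzn n : measurable_fun [set: S] (zn n).
  apply: measurable_minr; last exact: measurable_cst.
  by apply: measurableT_comp => //; exact: normr_measurable.
have mznT n := sub_measurable_fun subG (mzn n).
have bound n : Ex (fun w => `|F w| * zn n w) <= Ex (fun w => `|f w * z w|).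
  have i1 : intg (fun w => f w * (u w * zn n w)).
    apply: (integrable_norm_le _ _ (integrable_norm fzi)).
      apply: measurable_funM => //; apply: measurable_funM => //.
      exact: sub_measurable_fun mu.
    move=> w /=; rewrite !normrM u1 mul1r ler_wpM2l// ger0_norm//.
    by rewrite /zn ge_min lexx.
  have i2 : intg (fun w => F w * (u w * zn n w)).
    apply: (@integrable_norm_le _ (fun w => n%:R * `|F w|)).
    - apply: measurable_funM => //; apply: measurable_funM => //.
      exact: sub_measurable_fun mu.
    - move=> w /=; rewrite !normrM u1 mul1r mulrC ler_wpM2r// ger0_norm//.
      by rewrite /zn ge_min lexx orbT.
    - exact: integrableZl measurableT _ _ (integrable_norm Fi).
  have e := eq_Rintegral_mul_sub fi Fi fF (measurable_funM mu (mzn n)) i1 i2.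
  rewrite (@eq_Rintegral _ _ _ _ _ (fun w => F w * (u w * zn n w))); last first.
    by move=> w _; rewrite mulrA uF.
  rewrite e; apply: le_Rintegral => //; first exact: integrable_norm fzi.
  move=> w _; rewrite (le_trans (ler_norm _))// !normrM u1 mul1r ler_wpM2l//.
  by rewrite ger0_norm// /zn ge_min lexx.
have iFzn n : intg (fun w => `|F w| * zn n w).
  apply: (@integrable_norm_le _ (fun w => n%:R * `|F w|)).
  - apply: measurable_funM => //.
    by apply: measurableT_comp => //; exact: normr_measurable.
  - move=> w; rewrite normrM normr_id mulrC ler_wpM2r// ger0_norm//.
    by rewrite /zn ge_min lexx orbT.
  - exact: integrableZl measurableT _ _ (integrable_norm Fi).
apply/integrableP; split; first exact/measurable_EFinP/measurable_funM.
(* The truncation is inactive once [n >= |z w|], so this increasing sequence is eventually constant.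
   Monotone convergence then turns the uniform [bound] into integrability. *)
have limE w : limn (fun n => (`|F w| * zn n w)%:E) = `|(F w * z w)%:E|%E.
  apply: lim_near_cst => //; near=> n.
  rewrite abse_EFin normrM; congr (_ * _)%:E.
  apply/min_idPl; near: n; exact: nbhs_infty_ger.
under eq_integral do rewrite -limE.
rewrite monotone_convergence//.
- apply: (@le_lt_trans _ _ (Ex (fun w => `|f w * z w|))%:E); last exact: ltry.
  apply: lime_le.
    apply: ereal_nondecreasing_is_cvgn => m n mn.
    apply: ge0_le_integral => //.
    + by move=> w _; rewrite lee_fin mulr_ge0.
    + exact: measurable_int (iFzn m).
    + exact: measurable_int (iFzn n).
    + move=> w _; rewrite lee_fin ler_wpM2l// /zn le_min !ge_min lexx /=.
      by rewrite ler_nat mn orbT.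
  apply: nearW => n; rewrite -[leLHS]fineK; last exact: integrable_fin_num (iFzn n).
  by rewrite lee_fin; exact: bound.
- by move=> n; exact: measurable_int (iFzn n).
- by move=> n w _; rewrite lee_fin mulr_ge0.
- move=> w _ m n mn; rewrite lee_fin ler_wpM2l// /zn le_min !ge_min lexx /=.
  by rewrite ler_nat mn orbT.
Unshelve. all: end_near. Qed.

(** Take [E] to be the event [Y > 0], which lies in [<<s G>>]: the integral of [Y] over it is both
    nonnegative and nonpositive, so [Y] times its indicator vanishes almost everywhere. *)
Lemma ae_le0_sub (Y : T -> R) : intg Y -> measurable_fun [set: S] Y ->
    (forall E, <<s G>> E -> \int[P]_(w in E) Y w <= 0) ->
  {ae P, forall w, Y w <= 0}.
Proof.
move=> Yi mY Y0.
have GE : measurable (([set w | 0 < Y w]) : set S).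
  rewrite -[X in measurable X]setTI.
  rewrite (_ : setT `&` _ = setT `&` ~` [set w | Y w <= 0]); last first.
    by congr (_ `&` _); apply/seteqP; split => w /=; rewrite ltNge => /negP.
  rewrite setTI; apply: measurableC; rewrite -[X in measurable X]setTI.
  exact: (measurable_fun_le measurableT mY (measurable_cst _)).
have mE := subG GE.
have iY := integrable_mul_indic mE Yi.
have Yp w : 0 <= Y w * \1_[set w | 0 < Y w] w.
  rewrite indicE; have [Yw|Yw] := ltP 0 (Y w).
    by rewrite mem_set//= mulr1 ltW.
  by rewrite memNset/= ?mulr0//; apply/negP; rewrite -leNgt.
have := (ae_eq_integral_abs P measurableT (measurable_int P iY)).1.
have -> : (\int[P]_w `|(Y w * \1_[set w | 0 < Y w] w)%:E|)%E = 0%E.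
  under eq_integral do rewrite gee0_abs ?lee_fin//.
  rewrite -[LHS]fineK ?integrable_fin_num//; congr (_%:E).
  rewrite -[LHS]/(Ex (fun w => Y w * \1_[set w | 0 < Y w] w)).
  by apply/le_anti; rewrite Rintegral_indic Y0//= -Rintegral_indic Rintegral_ge0.
move=> /(_ erefl); apply: filterS => w /(_ Logic.I) /= [].
rewrite indicE leNgt; case: ltP => // Yw.
by rewrite mem_set//= mulr1 => Yw0; rewrite Yw0 ltxx in Yw.
Qed.

Lemma ae_eq_sub (Y Y' : T -> R) : intg Y -> intg Y' ->
    measurable_fun [set: S] Y -> measurable_fun [set: S] Y' ->
    (forall E, <<s G>> E -> \int[P]_(w in E) Y w = \int[P]_(w in E) Y' w) ->
  {ae P, forall w, Y w = Y' w}.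
Proof.
move=> Yi Yi' mY mY' YY'.
have H (Z Z' : T -> R) : intg Z -> intg Z' ->
    measurable_fun [set: S] Z -> measurable_fun [set: S] Z' ->
    (forall E, <<s G>> E -> \int[P]_(w in E) Z w = \int[P]_(w in E) Z' w) ->
    {ae P, forall w, Z w - Z' w <= 0}.
  move=> Zi Zi' mZ mZ' ZZ'; apply: ae_le0_sub.
  - exact: (integrableB measurableT Zi Zi').
  - exact: measurable_funB.
  - move=> E GE; have mE := subG GE.
    by rewrite RintegralB ?ZZ' ?subrr//; apply: integrableS measurableT _ _ _.
have YY'_le := H _ _ Yi Yi' mY mY' YY'.
have Y'Y_le := H _ _ Yi' Yi mY' mY (fun E GE => esym (YY' E GE)).
apply: filterS2 YY'_le Y'Y_le => w; rewrite !subr_le0 => ? ?.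
by apply/le_anti/andP.
Qed.

End PullOut.

(** Reduction to the countable case through [pickle]; a number that codes no element of [I] gives a
    vacuous condition. *)
Lemma ae_forall_fin (I : finType) (Q : I -> T -> Prop) :
  (forall i, {ae P, forall w, Q i w}) -> {ae P, forall w, forall i, Q i w}.
Proof.
move=> aeQ; pose Q' n w := forall i, pickle i = n -> Q i w.
have : {ae P, forall w, forall n, Q' n w}.
  apply: ae_foralln => n; have [[i <-]|nP] := pselect (exists i : I, pickle i = n).
    by apply: filterS (aeQ i) => w Qw j /(pcan_inj pickleK) ->.
  by apply: aeW => w i ni; case: nP; exists i.
by apply: filterS => w Qw i; exact: Qw.
Qed.

Lemma sub_gen_measurable_fun (G G' : set (set T)) (z : T -> R) : G `<=` <<s G'>> ->
  measurable_fun [set: g_sigma_algebraType G] z ->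
  measurable_fun [set: g_sigma_algebraType G'] z.
Proof.
move=> GG' mz _ B mB; have := mz measurableT B mB.
by apply: smallest_sub => //; exact: smallest_sigma_algebra.
Qed.

(** The events on which the two integrals agree form a Dynkin system; [G setT] supplies the equality
    of total integrals that complements require. *)
Lemma Rintegral_pi_lambda (G : set (set T)) (f F : T -> R) :
    G `<=` measurable -> setI_closed G -> G setT -> intg f -> intg F ->
    (forall E, G E -> \int[P]_(w in E) f w = \int[P]_(w in E) F w) ->
  forall E, <<s G>> E -> \int[P]_(w in E) f w = \int[P]_(w in E) F w.
Proof.
move=> mG GI GT fi Fi fF; rewrite -setI_closed_g_dynkin_g_sigma_algebra//.
pose H := [set E | measurable E /\ \int[P]_(w in E) f w = \int[P]_(w in E) F w].
suff : <<d G>> `<=` H by move=> GH E /GH[].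
apply: smallest_sub => [|E GE]; last by split; [exact: mG|exact: fF].
split.
- by split => //; exact: fF.
- move=> E [mE fFE]; split; first exact: measurableC.
  have C (g : T -> R) : intg g -> \int[P]_(w in ~` E) g w =
      Ex g - \int[P]_(w in E) g w.
    move=> gi; rewrite -(Rintegral_indic g (~` E)) -(Rintegral_indic g E) -RintegralB//; last first.
      exact: integrable_mul_indic.
    apply: eq_Rintegral => w _; rewrite !indicE in_setC.
    by case: (w \in E); rewrite /= ?mulr1 ?mulr0 ?subr0 ?subrr.
  by rewrite !C// fFE fF.
- move=> A tA HA; split; first by apply: bigcup_measurable => n _; exact: (HA n).1.
  have iS (g : T -> R) E : measurable E -> intg g -> P.-integrable E (EFin \o g).
    by move=> mE; exact: integrableS.
  have mA n : measurable (A n) := (HA n).1.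
  have mU : measurable (\bigcup_k A k) by exact: bigcup_measurable.
  congr fine; rewrite !integral_bigcup//; try exact: iS.
  apply: eq_eseriesr => n _.
  rewrite -[LHS]fineK; last by apply: integrable_fin_num => //; exact: iS.
  rewrite -[RHS]fineK; last by apply: integrable_fin_num => //; exact: iS.
  by congr (_%:E); exact: (HA n).2.
Qed.

Lemma integrable_mul_ae_bounded (Z g : T -> R) : measurable_fun setT Z ->
  {ae P, forall w, 0 <= Z w <= 1} -> intg g -> intg (fun w => Z w * g w).
Proof.
move=> mZ Z01 gi.
have mg : measurable_fun setT g by apply/measurable_EFinP; exact: measurable_int gi.
(* Clamping gives bounds that hold everywhere and changes [Z] only on a null set. *)
pose Z' w := Order.max 0 (Order.min 1 (Z w)).
have Z'i : intg (fun w => Z' w * g w).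
  apply: (integrable_norm_le _ _ (integrable_norm gi)).
    apply: measurable_funM => //; apply: measurable_maxr; first exact: measurable_cst.
    by apply: measurable_minr => //; exact: measurable_cst.
  move=> w /=; rewrite normrM ler_piMl// ger0_norm /Z' ?le_max ?lexx//.
  by rewrite ge_max ler01 ge_min lexx.
apply: (eq_Rint_ae Z'i _ _).1; first exact: measurable_funM.
apply: filterS Z01 => w /andP[Z0 Z1].
by rewrite /Z' (min_idPr Z1) (max_idPr Z0).
Qed.

Section sigma_of_theory.
Variables (n : nat) (X : T -> 'cV[R]_n).

Lemma sigma_of_id : <<s sigma_of X>> = sigma_of X.
Proof. by apply: sigma_algebra_id; exact: smallest_sigma_algebra. Qed.

Lemma sigma_of_measurable : random_vector X -> <<s sigma_of X>> `<=` measurable.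
Proof.
move=> mX; rewrite sigma_of_id; apply: smallest_sub.
  exact: sigma_algebra_measurable.
apply: (big_ind (fun A : set (set T) => A `<=` measurable)) => //.
- by move=> A B mA mB E [/mA|/mB].
- by move=> i _ _ [B mB <-]; exact: mX.
Qed.

Lemma measurable_coord i :
  measurable_fun [set: g_sigma_algebraType (sigma_of X)] (fun w => X w i 0).
Proof.
move=> _ B mB; apply: sub_sigma_algebra; apply: sub_sigma_algebra.
by rewrite (bigD1 i)//=; left; exists B.
Qed.

Lemma sigma_ofT : sigma_of X setT.
Proof. by rewrite -sigma_of_id; exact: (@measurableT _ (g_sigma_algebraType (sigma_of X))). Qed.

Lemma sigma_ofI A B : sigma_of X A -> sigma_of X B -> sigma_of X (A `&` B).
Proof. by rewrite -sigma_of_id; exact: (@measurableI _ (g_sigma_algebraType (sigma_of X))). Qed.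

Lemma cond_expectationE f F : is_cond_expectation P (sigma_of X) f F ->
  [/\ intg f, intg F, measurable_fun [set: g_sigma_algebraType (sigma_of X)] F &
  forall E, <<s sigma_of X>> E -> \int[P]_(w in E) f w = \int[P]_(w in E) F w].
Proof.
case=> fi Fi mF fF; split => //.
  move=> _ B mB; rewrite -[measurable]/(<<s sigma_of X>>) sigma_of_id.
  by apply: mF; exists B.
by move=> E; rewrite sigma_of_id => GE; congr fine; exact: fF.
Qed.

End sigma_of_theory.

(** * Conditional independence *)

Section conditional_independence.
Variables (k : nat) (h : T -> 'cV[R]_k) (m : nat) (n : 'I_m -> nat).
Variable x : forall v : 'I_m, T -> 'cV[R]_(n v).
Hypothesis mh : random_vector h.
Hypothesis mx : forall v, random_vector (x v).
Hypothesis indep : conditionally_independent P (sigma_of h) x.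
Variable v : 'I_m.

(** A pi-system generating the sigma-algebra of [h] and the views other than [v]. The family stays
    indexed by all views, with [A v = setT], so that [conditionally_independent] applies to it
    directly. *)
Definition other_events : set (set T) := [set E |
  exists A D, [/\ forall u, sigma_of (x u) (A u), A v = setT, sigma_of h D &
    E = \bigcap_u A u `&` D]].

Lemma other_events_setI : setI_closed other_events.
Proof.
move=> _ _ [A [D [sA Av sD ->]]] [A' [D' [sA' Av' sD' ->]]].
exists (fun u => A u `&` A' u), (D `&` D'); split.
- by move=> u; exact: sigma_ofI.
- by rewrite Av Av' setTI.
- exact: sigma_ofI.
- by rewrite bigcapI setIACA.
Qed.

Lemma other_events_setT : other_events setT.
Proof.
exists (fun=> setT), setT; split => //.
- by move=> u; exact: sigma_ofT.
- exact: sigma_ofT.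
- by rewrite setIT; apply/seteqP; split.
Qed.

Lemma sigma_of_factors_other : sigma_of h `<=` other_events.
Proof.
move=> D sD; exists (fun=> setT), D; split => //.
- by move=> u; exact: sigma_ofT.
- by apply/seteqP; split=> w // [].
Qed.

Lemma sigma_of_view_other u : u != v -> sigma_of (x u) `<=` other_events.
Proof.
move=> uv B sB; exists (fun u' => if u' == u then B else setT), setT; split.
- by move=> u'; case: eqP => [->//|_]; exact: sigma_ofT.
- by rewrite eq_sym (negbTE uv).
- exact: sigma_ofT.
- rewrite setIT; apply/seteqP; split => w.
    by move=> Bw u' _ /=; case: ifP.
  by move=> /(_ u Logic.I); rewrite eqxx.
Qed.

Let views_measurable u E : sigma_of (x u) E -> measurable E.
Proof. by move=> sE; have := sigma_of_measurable (@mx u); rewrite sigma_of_id; exact. Qed.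

Let factors_measurable E : sigma_of h E -> measurable E.
Proof. by move=> sE; apply: (sigma_of_measurable mh); rewrite sigma_of_id. Qed.

Lemma other_events_measurable : other_events `<=` measurable.
Proof.
move=> _ [A [D [sA Av sD ->]]]; apply: measurableI; last exact: factors_measurable.
by apply: fin_bigcap_measurable => // u _; exact: views_measurable (sA u).
Qed.

Let Sh := g_sigma_algebraType (sigma_of h).

(** Over an event [D] of [sigma_of h] the integral of [Y] is that of [\1_E], hence between 0 and the
    probability of [D]; [ae_le0_sub] applies to [Y - 1] and to [- Y]. *)
Lemma cond_prob_bounds E Y : is_cond_expectation P (sigma_of h) \1_E Y ->
  {ae P, forall w, 0 <= Y w <= 1}.
Proof.
move=> /cond_expectationE[Ei Yi mY EY].
have c1 : intg (cst 1) by exact: finite_measure_integrable_cst.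
have le1 : {ae P, forall w, Y w - 1 <= 0}.
  apply: (ae_le0_sub (sigma_of_measurable mh)).
  - exact: (integrableB measurableT Yi c1).
  - by apply: measurable_funB => //; exact: measurable_cst.
  - move=> D sD; have mD := sigma_of_measurable mh sD.
    rewrite RintegralB//; [|exact: integrableS measurableT _ _ _..].
    rewrite -EY// subr_le0; apply: le_Rintegral;
      [by []|exact: integrableS measurableT _ _ Ei|
       exact: integrableS measurableT _ _ c1|].
    by move=> w _; rewrite indicE /= lern1 leq_b1.
have ge0 : {ae P, forall w, - Y w <= 0}.
  apply: (ae_le0_sub (sigma_of_measurable mh)).
  - exact: (integrableN Yi).
  - exact: measurable_funN.
  - move=> D sD; have mD := sigma_of_measurable mh sD.
    under eq_Rintegral do rewrite -mulN1r.
    rewrite RintegralZl//; last exact: integrableS measurableT _ _ Yi.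
    rewrite -EY// mulN1r oppr_le0; apply: Rintegral_ge0 => w _.
    by rewrite indicE.
apply: filterS2 le1 ge0 => w; rewrite subr_le0 oppr_le0 => ? ?.
exact/andP.
Qed.

Lemma cond_expectation_ae E Y Y' : is_cond_expectation P (sigma_of h) \1_E Y ->
  is_cond_expectation P (sigma_of h) \1_E Y' -> {ae P, forall w, Y w = Y' w}.
Proof.
move=> /cond_expectationE[_ Yi mY EY] /cond_expectationE[_ Yi' mY' EY'].
apply: (ae_eq_sub (sigma_of_measurable mh)) => // D sD.
by rewrite -EY// EY'.
Qed.

Lemma cond_expectationT : is_cond_expectation P (sigma_of h) \1_setT (cst 1).
Proof.
split.
- exact: integrable_indic.
- exact: finite_measure_integrable_cst.
- move=> _ [B mB <-]; rewrite setTI -sigma_of_id.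
  have : measurable_fun [set: g_sigma_algebraType (sigma_of h)] (cst (1 : R)).
    exact: measurable_cst.
  by move=> /(_ measurableT B mB); rewrite setTI.
- by move=> A sA; under eq_integral do rewrite indicT.
Qed.

Section fixed_events.
Variables (A : 'I_m -> set T) (Z : T -> R).
Hypothesis sA : forall u, sigma_of (x u) (A u).
Hypothesis Av : A v = setT.
Hypothesis condZ : is_cond_expectation P (sigma_of h) \1_(\bigcap_u A u) Z.

(* [E[1_(C `&` A) | h] = E[1_C | h] E[1_A | h]] with a version [Z] of the second
   factor that does not depend on [C]. *)
Let swap_event C D : sigma_of (x v) C -> sigma_of h D ->
  \int[P]_(w in C) (\1_(\bigcap_u A u) w * \1_D w) =
  \int[P]_(w in C) (Z w * \1_D w).
Proof.
move=> sC sD.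
have mC := views_measurable sC; have mD := factors_measurable sD.
have [Y [condY condYp]] := indep sA.
(* The full event in slot [v] is replaced by [C], the other events being kept. *)
pose A' u := if u == v then C else A u.
have sA' u : sigma_of (x u) (A' u).
  by rewrite /A'; case: eqP => [->|_].
have [Y' [condY' condYp']] := indep sA'.
have A'E : \bigcap_u A' u = C `&` \bigcap_u A u.
  apply/seteqP; split => w.
    move=> Aw; have := Aw v Logic.I; rewrite /A' eqxx => Cw; split => // u _.
    have := Aw u Logic.I; rewrite /A'; case: eqP => // -> _.
    by rewrite Av.
  by move=> [Cw Aw] u _; rewrite /A'; case: eqP => // _; exact: Aw.
have Y'v : is_cond_expectation P (sigma_of h) \1_C (Y' v).
  by have := condY' v; rewrite /A' eqxx.
(* The versions for [A] and [A'] are unrelated a priori. By uniqueness they agree almost everywhere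
   off [v], and [Y v] is 1 there, so the factors other than [Y' v] multiply to [Z]. *)
have YE : {ae P, forall w, \prod_u Y' u w = Y' v w * Z w}.
  have e1 : {ae P, forall w, Y v w = 1}.
    apply: (cond_expectation_ae _ cond_expectationT).
    by have := condY v; rewrite Av.
  have e2 : {ae P, forall w, \prod_u Y u w = Z w}.
    exact: cond_expectation_ae condYp condZ.
  have e3 : {ae P, forall w u, u != v -> Y u w = Y' u w}.
    apply: ae_forall_fin => u; have [->|uv] := eqVneq u v.
      by apply: aeW => w /negP.
    have cY : is_cond_expectation P (sigma_of h) \1_(A u) (Y' u).
      by have := condY' u; rewrite /A' (negbTE uv).
    by apply: filterS (cond_expectation_ae (condY u) cY).
  apply: filterS3 e1 e2 e3 => w Yv <- YY'.
  rewrite (bigD1 v)//= [in RHS](bigD1 v)//= Yv mul1r; congr (_ * _).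
  by apply: eq_bigr => u uv; rewrite YY'.
have [_ Zi mZ _] := cond_expectationE condZ.
have [_ Y'vi mY'v Y'vE] := cond_expectationE Y'v.
have [_ Ypi mYp YpE] := cond_expectationE condYp'.
have mZD : measurable_fun [set: Sh] (fun w => Z w * \1_D w).
  apply: measurable_funM => //; apply: measurable_indic.
  by rewrite -[measurable]/(<<s sigma_of h>>) sigma_of_id.
have iZD := integrable_mul_indic mD Zi.
(* The chain is [E[1_C Z 1_D] = E[Y'_v Z 1_D]], which is the integral over [D] of the product of the
   [Y'_u], hence that of the indicator of the intersection of the [A'_u]. *)
have [] := pull_out (sigma_of_measurable mh) (integrable_indic P mC) Y'vi Y'vE mY'v mZD.
  apply: integrable_eq (integrable_mul_indic mC iZD) => w.
  by rewrite mulrC.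
move=> i1 e1.
transitivity (Ex (fun w => \1_C w * (Z w * \1_D w))); last first.
  by rewrite -[RHS]Rintegral_indic; apply: eq_Rintegral => w _; rewrite mulrC.
rewrite -e1; transitivity (\int[P]_(w in D) (\prod_u Y' u w)).
  rewrite -YpE ?sigma_of_id// -[LHS]Rintegral_indic -[RHS]Rintegral_indic.
  apply: eq_Rintegral => w _; rewrite A'E indicI /=.
  by rewrite mulrAC (mulrC (\1_(\bigcap_u A u) w)).
rewrite -[LHS]Rintegral_indic.
apply: (eq_Rint_ae _ _ _).2.
- exact: integrable_mul_indic.
- by apply/measurable_EFinP; exact: measurable_int i1.
- by apply: filterS YE => w ->; rewrite mulrA.
Qed.

(** With [1_A] the indicator of the intersection, [E[1_A 1_D f] = E[Z 1_D f] = E[Z 1_D F] =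
    E[1_A 1_D F]]. The first equality extends [swap_event] from events of view [v] to [f], the
    second uses that [Z 1_D] is a function of [h], the third that [F 1_D] is one. *)
Lemma cond_indep_event (f F : T -> R) D :
  measurable_fun [set: g_sigma_algebraType (sigma_of (x v))] f ->
  is_cond_expectation P (sigma_of h) f F -> sigma_of h D ->
  \int[P]_(w in \bigcap_u A u `&` D) f w =
  \int[P]_(w in \bigcap_u A u `&` D) F w.
Proof.
move=> mf condF sD; have mD := factors_measurable sD.
have mA : measurable (\bigcap_u A u).
  have mAu u : measurable (A u) by exact: views_measurable (@sA u).
  by apply: fin_bigcap_measurable => // u _; exact: mAu.
have [Ai Zi mZ ZE] := cond_expectationE condZ.
have [fi Fi mF FE] := cond_expectationE condF.
have mDh : measurable_fun [set: Sh] (\1_D : T -> R).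
  by apply: measurable_indic; rewrite -[measurable]/(<<s sigma_of h>>) sigma_of_id.
have Z01 := cond_prob_bounds condZ.
have mZT := sub_measurable_fun (sigma_of_measurable mh) mZ.
have iZf : intg (fun w => Z w * \1_D w * f w).
  apply: integrable_eq (integrable_mul_ae_bounded mZT Z01 (integrable_mul_indic mD fi)).
  by move=> w; rewrite mulrA mulrAC.
have iZF : intg (fun w => Z w * (F w * \1_D w)).
  exact: integrable_mul_ae_bounded mZT Z01 (integrable_mul_indic mD Fi).
have E1 : Ex (fun w => Z w * \1_D w * f w) =
    Ex (fun w => \1_(\bigcap_u A u) w * \1_D w * f w).
  apply: (eq_Rintegral_mul_sub (sigma_of_measurable (@mx v))) mf _ iZf.
  - exact: integrable_mul_indic.
  - exact: integrable_mul_indic.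
  - by move=> C; rewrite sigma_of_id => sC; exact: swap_event.
  - apply: integrable_eq (integrable_mul_indic mA (integrable_mul_indic mD fi)) => w.
    by rewrite mulrC mulrA mulrAC.
have E2 : Ex (fun w => F w * (Z w * \1_D w)) = Ex (fun w => f w * (Z w * \1_D w)).
  apply: (eq_Rintegral_mul_sub (sigma_of_measurable mh)) => //.
  - exact: measurable_funM.
  - by apply: integrable_eq iZf => w; rewrite mulrC.
  - by apply: integrable_eq iZF => w; rewrite mulrCA.
have E3 : Ex (fun w => Z w * (F w * \1_D w)) =
    Ex (fun w => \1_(\bigcap_u A u) w * (F w * \1_D w)).
  apply: (eq_Rintegral_mul_sub (sigma_of_measurable mh)) => //.
  - exact: measurable_funM.
  - apply: integrable_eq (integrable_mul_indic mA (integrable_mul_indic mD Fi)) => w.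
    by rewrite mulrC.
rewrite -[LHS]Rintegral_indic -[RHS]Rintegral_indic.
transitivity (Ex (fun w => \1_(\bigcap_u A u) w * \1_D w * f w)).
  by apply: eq_Rintegral => w _; rewrite indicI mulrC.
rewrite -E1; transitivity (Ex (fun w => f w * (Z w * \1_D w))).
  by apply: eq_Rintegral => w _; rewrite mulrC.
rewrite -E2; transitivity (Ex (fun w => Z w * (F w * \1_D w))).
  by apply: eq_Rintegral => w _; rewrite mulrCA.
rewrite E3; apply: eq_Rintegral => w _; rewrite indicI /=.
by rewrite mulrCA.
Qed.

End fixed_events.

(** The pi-system argument extends [cond_indep_event] to the generated sigma-algebra, for which [F]
    is measurable as a function of [h]; then [pull_out] applies. Integrability of [F z] belongs to
    the conclusion because the next replacement starts from it. *)
Lemma cond_indep_pull_out (f F z : T -> R) :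
  measurable_fun [set: g_sigma_algebraType (sigma_of (x v))] f ->
  is_cond_expectation P (sigma_of h) f F ->
  measurable_fun [set: g_sigma_algebraType other_events] z ->
  intg (fun w => f w * z w) ->
  intg (fun w => F w * z w) /\
  Ex (fun w => F w * z w) = Ex (fun w => f w * z w).
Proof.
move=> mf condF mz fzi; have [fi Fi mF FE] := cond_expectationE condF.
have subO : <<s other_events>> `<=` measurable.
  apply: smallest_sub; first exact: sigma_algebra_measurable.
  exact: other_events_measurable.
apply: (pull_out subO) => //; last first.
  apply: sub_gen_measurable_fun mF => D /sigma_of_factors_other.
  exact: sub_sigma_algebra.
apply: Rintegral_pi_lambda => //.
- exact: other_events_measurable.
- exact: other_events_setI.
- exact: other_events_setT.
- move=> _ [A [D [sA Av sD ->]]].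
  have [Y [_ condZ]] := indep sA.
  exact: cond_indep_event condZ _ _ _ mf condF sD.
Qed.

End conditional_independence.

Lemma integrable_lincomb I (s : seq I) (a : I -> R) (f : I -> T -> R) D :
    measurable D -> (forall i, P.-integrable D (EFin \o f i)) ->
  P.-integrable D (EFin \o (fun w => \sum_(i <- s) a i * f i w)) /\
  \int[P]_(w in D) (\sum_(i <- s) a i * f i w) =
  \sum_(i <- s) a i * \int[P]_(w in D) f i w.
Proof.
move=> mD fi; elim: s => [|i s [IHi IHs]].
  rewrite big_nil; under eq_fun do rewrite big_nil; split.
    exact: integrable0.
  by rewrite Rintegral_cst// mul0r.
have ai : P.-integrable D (EFin \o (fun w => a i * f i w)).
  exact: (integrableZl mD (a i) (fi i)).
under eq_fun do rewrite big_cons; split.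
  exact: (integrableD mD ai IHi).
by rewrite RintegralD// IHs RintegralZl// big_cons.
Qed.

(** * Moments *)

Section independence.
Variables (k : nat) (X : T -> 'cV[R]_k).
Hypothesis mX : random_vector X.
Hypothesis indepX : mutually_independent P X.
Variable i : 'I_k.

Definition other_coord_events : set (set T) := [set E |
  exists2 B : 'I_k -> set R, forall j, measurable (B j) &
    E = \bigcap_(j in [set j | j != i]) [set w | B j (X w j 0)]].

Definition coord_events : set (set T) :=
  preimage_set_system setT (fun w => X w i 0) measurable.

Let coord_measurable j B : measurable B -> measurable [set w | B (X w j 0)].
Proof. by move=> mB; have := @mX j measurableT B mB; rewrite setTI. Qed.

Lemma other_coord_events_setI : setI_closed other_coord_events.
Proof.
move=> _ _ [B mB ->] [B' mB' ->]; exists (fun j => B j `&` B' j).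
  by move=> j; exact: measurableI.
by rewrite -bigcapI.
Qed.

Lemma other_coord_events_setT : other_coord_events setT.
Proof. by exists (fun=> setT) => //; apply/seteqP; split. Qed.

Lemma other_coord_events_measurable : other_coord_events `<=` measurable.
Proof.
move=> _ [B mB ->]; apply: fin_bigcap_measurable => [|j _].
  have kfin : finite_set [set: 'I_k] by [].
  exact: sub_finite_set (@subsetT _ _) kfin.
exact: coord_measurable.
Qed.

Lemma measurable_other_coord j : j != i ->
  measurable_fun [set: g_sigma_algebraType other_coord_events] (fun w => X w j 0).
Proof.
move=> ji _ B mB; rewrite setTI; apply: sub_sigma_algebra.
exists (fun j' => if j' == j then B else setT).
  by move=> j'; case: ifP.
apply/seteqP; split => w.
  by move=> Bw j' _ /=; case: eqP => // ->.
by move=> /(_ j ji); rewrite /= eqxx.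
Qed.

Lemma coord_events_id : <<s coord_events>> = coord_events.
Proof.
apply: sigma_algebra_id.
exact/sigma_algebra_preimage/sigma_algebra_measurable.
Qed.

Lemma coord_events_measurable : <<s coord_events>> `<=` measurable.
Proof. by rewrite coord_events_id => _ [B mB <-]; exact: mX. Qed.

(** The product formula is used twice, for all indices and for all indices but [i]. *)
Let independent_events A E : coord_events A -> other_coord_events E ->
  (P (A `&` E) = P A * P E)%E.
Proof.
move=> [B mB <-] [C mC ->]; rewrite setTI.
pose C' j := if j == i then B else C j.
have mC' j : measurable (C' j) by rewrite /C'; case: ifP.
have -> : (fun w => X w i 0) @^-1` B `&`
    \bigcap_(j in [set j | j != i]) [set w | C j (X w j 0)] =
    \bigcap_(j in [set` [set: 'I_k]%SET]) [set w | C' j (X w j 0)].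
  apply/seteqP; split => w.
    move=> [Bw Cw] j _ /=; rewrite /C'; case: eqP => [->//|/eqP ji].
    exact: Cw.
  move=> Cw; split.
    by have := Cw i; rewrite /= /C' eqxx; apply; rewrite inE.
  by move=> j /= ji; have := Cw j; rewrite /= /C' (negbTE ji); apply; rewrite inE.
have -> : \bigcap_(j in [set j | j != i]) [set w | C j (X w j 0)] =
    \bigcap_(j in [set` [set~ i]%SET]) [set w | C j (X w j 0)].
  by congr bigcap; apply/seteqP; split => j /=; rewrite !inE.
rewrite !indepX// (bigD1 i) ?inE//= /C' eqxx; congr (_ * _)%E.
apply: eq_big => [j|j]; first by rewrite !inE.
by rewrite !inE => /andP[_ ji]; rewrite (negbTE ji).
Qed.

(** Against events of coordinate [i], the indicator of [E] integrates like the constant [P E];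
    testing with [f] gives [E[f 1_E] = P(E) E[f] = 0]. This extends to the sigma-algebra of the
    other coordinates, and [f] is then orthogonal to [z]. *)
Lemma independent_pull_out (f z : T -> R) :
  measurable_fun [set: g_sigma_algebraType coord_events] f ->
  measurable_fun [set: g_sigma_algebraType other_coord_events] z ->
  intg f -> Ex f = 0 -> intg (fun w => f w * z w) -> Ex (fun w => f w * z w) = 0.
Proof.
move=> mf mz fi f0 fzi.
have subO : <<s other_coord_events>> `<=` measurable.
  apply: smallest_sub; first exact: sigma_algebra_measurable.
  exact: other_coord_events_measurable.
have fE E : other_coord_events E -> \int[P]_(w in E) f w = 0.
  move=> OE; have mE := other_coord_events_measurable OE.
  have iE : intg (\1_E : T -> R) by exact: integrable_indic.
  have ic : intg (cst (fine (P E))) by exact: finite_measure_integrable_cst.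
  have e : Ex (fun w => fine (P E) * f w) = Ex (fun w => \1_E w * f w).
    apply: (eq_Rintegral_mul_sub coord_events_measurable iE ic _ mf).
    - move=> A; rewrite coord_events_id => CA.
      have mA : measurable A.
        by apply: coord_events_measurable; rewrite coord_events_id.
      rewrite Rintegral_cst// -Rintegral_indic.
      rewrite (@eq_Rintegral _ _ _ _ _ (\1_(E `&` A))); last first.
        by move=> w _; rewrite indicI.
      rewrite /Rintegral integral_indic//; last exact: measurableI.
      transitivity (fine (P (A `&` E))).
        by congr (fine (P _)); apply/seteqP; split => w /=; tauto.
      by rewrite independent_events// fineM ?fin_num_measure// mulrC.
    - by apply: integrable_eq (integrable_mul_indic mE fi) => w; rewrite mulrC.
    - exact: (integrableZl measurableT _ fi).
  rewrite -Rintegral_indic.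
  under eq_Rintegral do rewrite mulrC.
  by rewrite -e RintegralZl// f0 mulr0.
apply: (Rintegral_mul_sub_measurable subO fi _ mz fzi) => E sE.
have -> : \int[P]_(w in E) f w = \int[P]_(w in E) (cst 0 w).
  apply: (Rintegral_pi_lambda _ _ _ fi _ _ sE).
  - exact: other_coord_events_measurable.
  - exact: other_coord_events_setI.
  - exact: other_coord_events_setT.
  - exact: integrable0.
  - move=> E' OE'; rewrite fE// Rintegral_cst ?mul0r//.
    exact: other_coord_events_measurable.
by rewrite Rintegral_cst ?mul0r//; exact: subO.
Qed.

End independence.

Lemma measurable_fun_coord_events k (X : T -> 'cV[R]_k) i :
  measurable_fun [set: g_sigma_algebraType (coord_events X i)] (fun w => X w i 0).
Proof. by move=> _ B mB; apply: sub_sigma_algebra; exists B. Qed.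

Section factor_moments.
Variables (k : nat) (h : T -> 'cV[R]_k).
Hypothesis mh : random_vector h.
Hypothesis indep_h : mutually_independent P h.
Hypothesis ih1 : forall i, P.-integrable setT (fun w => (h w i 0)%:E).
Hypothesis ih2 : forall i,
  P.-integrable setT (fun w => (centered P h w i 0 ^+ 2)%:E).
Hypothesis ih3 : forall i,
  P.-integrable setT (fun w => (centered P h w i 0 ^+ 3)%:E).

Local Notation c i w := (centered P h w i 0).

Lemma centeredE n (X : T -> 'cV[R]_n) i w :
  centered P X w i 0 = X w i 0 - Ex (fun w => X w i 0).
Proof. by rewrite !mxE unlock. Qed.

Lemma central_momentE n (X : T -> 'cV[R]_n) i p :
  central_moment P X i p = Ex (fun w => centered P X w i 0 ^+ p).
Proof. by rewrite /central_moment unlock. Qed.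

Lemma integrable_centered n (X : T -> 'cV[R]_n) i :
  intg (fun w => X w i 0) -> intg (fun w => centered P X w i 0).
Proof.
move=> Xi; apply: (integrable_eq (f := fun w => X w i 0 - Ex (fun w => X w i 0))).
  by move=> w; rewrite centeredE.
exact: (integrableB measurableT Xi (finite_measure_integrable_cst _ _ measurableT)).
Qed.

Lemma expectation_centered n (X : T -> 'cV[R]_n) i :
  intg (fun w => X w i 0) -> Ex (fun w => centered P X w i 0) = 0.
Proof.
move=> Xi; under eq_Rintegral do rewrite centeredE.
rewrite RintegralB//; last exact: finite_measure_integrable_cst.
rewrite Rintegral_cst// [fine _](_ : _ = 1) ?mulr1 ?subrr//.
exact: (congr1 fine (probability_setT P)).
Qed.

Let mc i : measurable_fun setT (fun w => c i w).
Proof.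
by apply/measurable_EFinP; exact: measurable_int (integrable_centered (@ih1 i)).
Qed.

Let mc_coord i : measurable_fun [set: g_sigma_algebraType (coord_events h i)]
  (fun w => c i w).
Proof.
under eq_fun do rewrite centeredE.
by apply: measurable_funB; [exact: measurable_fun_coord_events|exact: measurable_cst].
Qed.

Let mc_other i j : j != i ->
  measurable_fun [set: g_sigma_algebraType (other_coord_events h i)]
  (fun w => c j w).
Proof.
move=> ji; under eq_fun do rewrite centeredE.
by apply: measurable_funB; [exact: measurable_other_coord|exact: measurable_cst].
Qed.

Lemma integrable_centered2 i j : intg (fun w => c i w * c j w).
Proof.
apply: (@integrable_norm_le _ (fun w => c i w ^+ 2 + c j w ^+ 2)).
- exact: measurable_funM.
- by move=> w; rewrite ler_norml; nra.
- exact: (integrableD measurableT (@ih2 i) (@ih2 j)).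
Qed.

Lemma integrable_centered3 i j l : intg (fun w => c i w * (c j w * c l w)).
Proof.
have n3 i' : intg (fun w => `|c i' w| ^+ 3).
  by apply: integrable_eq (integrable_norm (@ih3 i')) => w /=; rewrite normrX.
apply: (@integrable_norm_le _
  (fun w => `|c i w| ^+ 3 + (`|c j w| ^+ 3 + `|c l w| ^+ 3))).
- by apply: measurable_funM => //; exact: measurable_funM.
- move=> w; rewrite !normrM.
  have := normr_ge0 (c i w); have := normr_ge0 (c j w).
  have := normr_ge0 (c l w).
  move: `|c i w| `|c j w| `|c l w| => a b e e0 b0 a0.
  have H (x y : R) : 0 <= x -> 0 <= y -> 0 <= (x + y) * (x - y) ^+ 2.
    by move=> x0 y0; rewrite mulr_ge0 ?sqr_ge0// addr_ge0.
  have := H a b a0 b0; have := H b e b0 e0; have := H a e a0 e0.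
  (* This product is twice [a^3 + b^3 + e^3 - 3 a b e]. *)
  have : 0 <= (a + b + e) * ((a - b) ^+ 2 + (b - e) ^+ 2 + (a - e) ^+ 2).
    by rewrite mulr_ge0 ?addr_ge0 ?sqr_ge0.
  have : 0 <= a ^+ 3 + b ^+ 3 + e ^+ 3 by rewrite !addr_ge0 ?exprn_ge0.
  nra.
- exact: (integrableD measurableT (n3 i) (integrableD measurableT (n3 j) (n3 l))).
Qed.

Lemma covariance_factors i j :
  Ex (fun w => c i w * c j w) = (i == j)%:R * central_moment P h i 2.
Proof.
have [<-|ij] := eqVneq i j; first by rewrite mul1r central_momentE.
rewrite mul0r; apply: (independent_pull_out mh indep_h (@mc_coord i)).
- by apply: mc_other; rewrite eq_sym.
- exact: (integrable_centered (ih1 _)).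
- exact: (expectation_centered (ih1 _)).
- exact: integrable_centered2.
Qed.

(** Three indices are either all equal or one of them occurs exactly once; in the latter case that
    centered coordinate factors out with mean zero. *)
Lemma third_moment_factors i j l :
  Ex (fun w => c i w * (c j w * c l w)) =
  ((i == j) && (i == l))%:R * central_moment P h i 3.
Proof.
have single i' j' l' : j' != i' -> l' != i' ->
    Ex (fun w => c i' w * (c j' w * c l' w)) = 0.
  move=> ji li; apply: (independent_pull_out mh indep_h (@mc_coord i')).
  - by apply: measurable_funM; exact: mc_other.
  - exact: (integrable_centered (ih1 _)).
  - exact: (expectation_centered (ih1 _)).
  - exact: integrable_centered3.
have [<-{j}|ij] := eqVneq i j; last first.
  rewrite mul0r; have [<-{l}|il] := eqVneq i l.
    under eq_Rintegral do rewrite mulrCA.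
    by apply: single.
  by apply: single; rewrite eq_sym.
have [<-{l}|il] := eqVneq i l; last first.
  under eq_Rintegral do rewrite mulrA mulrC.
  by rewrite mul0r; apply: single.
by rewrite mul1r central_momentE.
Qed.

End factor_moments.

Section cond_expectation_closure.
Variables (k : nat) (h : T -> 'cV[R]_k).
Hypothesis mh : random_vector h.

Let sigma_h_measurable := sigma_of_measurable mh.

Lemma cond_expectationI (f F : T -> R) : intg f -> intg F ->
  measurable_fun [set: g_sigma_algebraType (sigma_of h)] F ->
  (forall E, <<s sigma_of h>> E -> \int[P]_(w in E) f w = \int[P]_(w in E) F w) ->
  is_cond_expectation P (sigma_of h) f F.
Proof.
move=> fi Fi mF fF; split => //.
  by move=> _ [B mB <-]; rewrite -sigma_of_id; exact: mF.
move=> A; rewrite -sigma_of_id => sA; have mA := sigma_h_measurable sA.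
rewrite -[LHS]fineK; last first.
  by apply: integrable_fin_num => //; exact: integrableS measurableT _ _ fi.
rewrite -[RHS]fineK; last first.
  by apply: integrable_fin_num => //; exact: integrableS measurableT _ _ Fi.
by congr (_%:E); exact: fF.
Qed.

Lemma cond_expectation_sum I (s : seq I) (a : I -> R) (f F : I -> T -> R) :
  (forall i, is_cond_expectation P (sigma_of h) (f i) (F i)) ->
  is_cond_expectation P (sigma_of h)
    (fun w => \sum_(i <- s) a i * f i w) (fun w => \sum_(i <- s) a i * F i w).
Proof.
move=> fF; have C i := cond_expectationE (fF i).
have fi i : intg (f i) by case: (C i).
have Fi i : intg (F i) by case: (C i).
apply: cond_expectationI.
- exact: (integrable_lincomb s a measurableT fi).1.
- exact: (integrable_lincomb s a measurableT Fi).1.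
- apply: measurable_sum => i; apply: measurable_funM; first exact: measurable_cst.
  by case: (C i).
- move=> E sE; have mE := sigma_h_measurable sE.
  have iS (g : T -> R) : intg g -> P.-integrable E (EFin \o g).
    exact: integrableS.
  rewrite (integrable_lincomb s a mE (fun i => iS _ (fi i))).2.
  rewrite (integrable_lincomb s a mE (fun i => iS _ (Fi i))).2.
  by apply: eq_bigr => i _; case: (C i) => _ _ _ ->.
Qed.

Lemma cond_expectation_subr (f F : T -> R) c :
  is_cond_expectation P (sigma_of h) f F ->
  is_cond_expectation P (sigma_of h) (fun w => f w - c) (fun w => F w - c).
Proof.
move=> /cond_expectationE[fi Fi mF fF].
have ci : intg (cst c) by exact: finite_measure_integrable_cst.
apply: cond_expectationI.
- exact: (integrableB measurableT fi ci).
- exact: (integrableB measurableT Fi ci).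
- by apply: measurable_funB => //; exact: measurable_cst.
- move=> E sE; have mE := sigma_h_measurable sE.
  have iS (g : T -> R) : intg g -> P.-integrable E (EFin \o g).
    exact: integrableS.
  rewrite (RintegralB mE (iS _ fi) (iS _ ci)) fF//.
  by rewrite -(RintegralB mE (iS _ Fi) (iS _ ci)).
Qed.

Lemma cond_expectation_mean (f F : T -> R) :
  is_cond_expectation P (sigma_of h) f F -> Ex f = Ex F.
Proof. by move=> /cond_expectationE[_ _ _]; apply; rewrite sigma_of_id; exact: sigma_ofT. Qed.

End cond_expectation_closure.

(** * Cross moments of the views *)

Section model_moments.
Variables (k : nat) (h : T -> 'cV[R]_k) (dim : 'I_3 -> nat).
Variable x : forall v : 'I_3, T -> 'cV[R]_(dim v).
Variable O : forall v : 'I_3, 'M[R]_(dim v, k).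
Hypothesis model : multiview_model P h x O.

Local Notation c i w := (centered P h w i 0).

Let mh := factors_rv model.
Let mx := views_rv model.
Let ih1 := factors_int model.

(** By total expectation [mu_v = O_v E[h]], so centering a view centers the factors in its
    conditional mean. *)
Lemma centered_view_cond_mean v a : is_cond_expectation P (sigma_of h)
  (fun w => centered P (x v) w a 0) (fun w => \sum_i O v a i * c i w).
Proof.
have C := views_cond_mean model a.
have e : Ex (fun w => x v w a 0) = \sum_i O v a i * Ex (fun w => h w i 0).
  rewrite (cond_expectation_mean C).
  rewrite -(integrable_lincomb _ _ measurableT ih1).2.
  by apply: eq_Rintegral => w _; rewrite mxE.
have := cond_expectation_subr mh (Ex (fun w => x v w a 0)) C.
congr is_cond_expectation; apply/funext => w; first by rewrite centeredE.
rewrite e mxE -sumrB; apply: eq_bigr => i _.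
by rewrite centeredE mulrBr.
Qed.

Lemma measurable_centered_view v a :
  measurable_fun [set: g_sigma_algebraType (sigma_of (x v))]
    (fun w => centered P (x v) w a 0).
Proof.
under eq_fun do rewrite centeredE.
by apply: measurable_funB; [exact: measurable_coord|exact: measurable_cst].
Qed.

Let measurable_factor_sum v (al : 'I_k -> R) :
  measurable_fun [set: g_sigma_algebraType (other_events h x v)]
    (fun w => \sum_i al i * c i w).
Proof.
apply: (@sub_gen_measurable_fun (sigma_of h)).
  by move=> E sE; apply: sub_sigma_algebra; exact: sigma_of_factors_other.
apply: measurable_sum => i; apply: measurable_funM; first exact: measurable_cst.
under eq_fun do rewrite centeredE.
by apply: measurable_funB; [exact: measurable_coord|exact: measurable_cst].
Qed.

Let measurable_view v v' (f : T -> R) : v' != v ->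
  measurable_fun [set: g_sigma_algebraType (sigma_of (x v'))] f ->
  measurable_fun [set: g_sigma_algebraType (other_events h x v)] f.
Proof.
move=> vv'; apply: sub_gen_measurable_fun => E sE; apply: sub_sigma_algebra.
exact: sigma_of_view_other sE.
Qed.

Let pull v := cond_indep_pull_out mh mx (views_cond_indep model) (v := v).

(** After the first replacement the test function depends on [h]; it is admissible for the second
    because [other_events] contains [sigma_of h]. *)
Lemma pair_moment v v' (f g : T -> R) (al be : 'I_k -> R) : v != v' ->
  measurable_fun [set: g_sigma_algebraType (sigma_of (x v))] f ->
  measurable_fun [set: g_sigma_algebraType (sigma_of (x v'))] g ->
  is_cond_expectation P (sigma_of h) f (fun w => \sum_i al i * c i w) ->
  is_cond_expectation P (sigma_of h) g (fun w => \sum_i be i * c i w) ->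
  intg (fun w => f w * g w) ->
  Ex (fun w => f w * g w) = \sum_i al i * be i * central_moment P h i 2.
Proof.
move=> vv' mf mg fF gG fgi.
have [Fgi <-] := pull mf fF (measurable_view (etrans (congr1 negb (eq_sym v' v)) vv') mg) fgi.
have gFi : intg (fun w => g w * \sum_i al i * c i w).
  by apply: integrable_eq Fgi => w; rewrite mulrC.
have [GFi GFE] := pull mg gG (@measurable_factor_sum v' al) gFi.
under eq_Rintegral do rewrite mulrC.
rewrite -GFE.
have e w : (\sum_i be i * c i w) * (\sum_i al i * c i w) =
    \sum_(p : 'I_k * 'I_k) (al p.1 * be p.2) * (c p.1 w * c p.2 w).
  rewrite mulrC big_distrlr/= pair_bigA/=; apply: eq_bigr => p _.
  by rewrite mulrACA.
under eq_Rintegral do rewrite e.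
rewrite (integrable_lincomb _ _ measurableT _).2; last first.
  by move=> p; exact: (integrable_centered2 ih1 (factors_int2 model)).
rewrite -(pair_bigA _ (fun i j => al i * be j * Ex (fun w => c i w * c j w)))/=.
apply: eq_bigr => i _; rewrite (bigD1 i)//= big1 ?addr0 => [|j ji].
  by rewrite (covariance_factors mh (factors_indep model) ih1 (factors_int2 model)) eqxx mul1r.
rewrite (covariance_factors mh (factors_indep model) ih1 (factors_int2 model)).
by rewrite eq_sym (negbTE ji) mul0r mulr0.
Qed.

(** General functions of the views, rather than coordinates, allow [q] to be the linear form
    [<eta, x_3 - mu_3>]. Each of the three replacements rotates the next view to the front. *)
Lemma triple_moment v1 v2 v3 (f g q : T -> R) (al be ga : 'I_k -> R) :
  v1 != v2 -> v1 != v3 -> v2 != v3 ->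
  measurable_fun [set: g_sigma_algebraType (sigma_of (x v1))] f ->
  measurable_fun [set: g_sigma_algebraType (sigma_of (x v2))] g ->
  measurable_fun [set: g_sigma_algebraType (sigma_of (x v3))] q ->
  is_cond_expectation P (sigma_of h) f (fun w => \sum_i al i * c i w) ->
  is_cond_expectation P (sigma_of h) g (fun w => \sum_i be i * c i w) ->
  is_cond_expectation P (sigma_of h) q (fun w => \sum_i ga i * c i w) ->
  intg (fun w => f w * (g w * q w)) ->
  Ex (fun w => f w * (g w * q w)) =
  \sum_i al i * be i * ga i * central_moment P h i 3.
Proof.
move=> v12 v13 v23 mf mg mq fF gG qQ fgqi.
have ne (u u' : 'I_3) : u != u' -> u' != u by rewrite eq_sym.
have [Fi <-] := pull mf fF (measurable_funM (measurable_view (ne _ _ v12) mg)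
  (measurable_view (ne _ _ v13) mq)) fgqi.
have gi : intg (fun w => g w * (q w * \sum_i al i * c i w)).
  by apply: integrable_eq Fi => w /=; rewrite mulrC mulrA.
have [Gi GE] := pull mg gG (measurable_funM (measurable_view (ne _ _ v23) mq)
  (@measurable_factor_sum v2 al)) gi.
have qi : intg (fun w => q w * ((\sum_i al i * c i w) * \sum_i be i * c i w)).
  by apply: integrable_eq Gi => w /=; rewrite mulrC mulrA.
have [Qi QE] := pull mq qQ (measurable_funM (@measurable_factor_sum v3 al)
  (@measurable_factor_sum v3 be)) qi.
transitivity (Ex (fun w => g w * (q w * \sum_i al i * c i w))).
  by apply: eq_Rintegral => w _ /=; rewrite mulrC mulrA.
rewrite -GE.
transitivity (Ex (fun w => q w * ((\sum_i al i * c i w) * \sum_i be i * c i w))).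
  by apply: eq_Rintegral => w _ /=; rewrite mulrC mulrA.
rewrite -QE.
have e w : (\sum_i ga i * c i w) *
    ((\sum_i al i * c i w) * (\sum_i be i * c i w)) =
    \sum_(p : 'I_k * ('I_k * 'I_k)) (ga p.1 * (al p.2.1 * be p.2.2)) *
      (c p.1 w * (c p.2.1 w * c p.2.2 w)).
  rewrite [X in _ * X]big_distrlr/= pair_bigA/= big_distrlr/= pair_bigA/=.
  by apply: eq_bigr => p _; ring.
under eq_Rintegral do rewrite e.
rewrite (integrable_lincomb _ _ measurableT _).2; last first.
  by move=> p; exact: (integrable_centered3 ih1 (factors_int3 model)).
have third := third_moment_factors mh (factors_indep model) ih1 (factors_int3 model).
rewrite -(pair_bigA _ (fun i (p : 'I_k * 'I_k) => ga i * (al p.1 * be p.2) *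
  Ex (fun w => c i w * (c p.1 w * c p.2 w))))/=.
apply: eq_bigr => i _; rewrite (bigD1 (i, i))//= big1 ?addr0 => [|[j l] /= jl].
  by rewrite third !eqxx mul1r; ring.
rewrite third; have [ij|_] := eqVneq i j; last by rewrite mul0r mulr0.
have [il|_] := eqVneq i l; last by rewrite mul0r mulr0.
by rewrite -ij -il eqxx in jl.
Qed.

Lemma PairsE v v' : v != v' ->
  Pairs P x v v' =
  O v *m diag_mx (\row_i central_moment P h i 2) *m (O v')^T.
Proof.
move=> vv'; apply/matrixP => a b.
have E w : pairs_rv P x v v' w a b = centered P (x v) w a 0 * centered P (x v') w b 0.
  by rewrite mxE big_ord1 [in X in _ * X]mxE.
rewrite mxE unlock.
transitivity (Ex (fun w => centered P (x v) w a 0 * centered P (x v') w b 0)).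
  by apply: eq_Rintegral => w _; exact: E.
rewrite (pair_moment vv' (@measurable_centered_view v a)
  (@measurable_centered_view v' b) (centered_view_cond_mean a)
  (centered_view_cond_mean b)).
  rewrite mxE; apply: eq_bigr => i _.
  by rewrite mul_mx_diag !mxE mulrAC.
by apply: integrable_eq (pairs_int model vv' a b) => w; exact: E.
Qed.

Lemma Triples132E eta :
  Triples132 P x eta =
  O view1 *m diag_mx (\row_i (central_moment P h i 3 * (eta^T *m O view3) 0 i))
    *m (O view2)^T.
Proof.
apply/matrixP => a b.
have E w : triples_rv P x eta w a b =
    centered P (x view1) w a 0 * (centered P (x view2) w b 0 *
     \sum_l eta l 0 * centered P (x view3) w l 0).
  rewrite mxE [pairs_rv _ _ _ _ _ _ _]mxE big_ord1 [X in _ * (_ * X)]mxE.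
  rewrite mulrC mulrA; congr (_ * _); rewrite mxE; apply: eq_bigr => l _.
  by rewrite mxE.
rewrite mxE unlock.
transitivity (Ex (fun w => centered P (x view1) w a 0 * (centered P (x view2) w b 0 *
     \sum_l eta l 0 * centered P (x view3) w l 0))).
  by apply: eq_Rintegral => w _; exact: E.
have c3 : is_cond_expectation P (sigma_of h)
    (fun w => \sum_l eta l 0 * centered P (x view3) w l 0)
    (fun w => \sum_i (eta^T *m O view3) 0 i * c i w).
  have := cond_expectation_sum mh (index_enum _) (fun l => eta l 0)
    (fun l => centered_view_cond_mean (v := view3) l).
  congr is_cond_expectation; apply/funext => w.
  under eq_bigr do rewrite big_distrr/=.
  rewrite exchange_big/=; apply: eq_bigr => i _.
  by rewrite [(_ *m _) _ _]mxE big_distrl/=; apply: eq_bigr => l _; rewrite [in RHS]mxE mulrA.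
have m3 : measurable_fun [set: g_sigma_algebraType (sigma_of (x view3))]
    (fun w => \sum_l eta l 0 * centered P (x view3) w l 0).
  apply: measurable_sum => l; apply: measurable_funM; first exact: measurable_cst.
  exact: measurable_centered_view.
rewrite (@triple_moment view1 view2 view3 _ _ _ _ _ _ isT isT isT
  (@measurable_centered_view view1 a) (@measurable_centered_view view2 b) m3
  (centered_view_cond_mean a) (centered_view_cond_mean b) c3).
  rewrite mxE; apply: eq_bigr => i _.
  by rewrite mul_mx_diag !mxE; ring.
by apply: integrable_eq (triples_int model eta a b) => w; exact: E.
Qed.

End model_moments.
End SubSigmaAlgebra.

(** * Whitening and simple singular vectors *)

Section LinearAlgebra.
Variable R : realType.

(** This is why the arbitrary choices [A] and [B] disappear: [Pairs3] and [Triples3] contain them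
    only in such products. *)
Lemma mulmx_invmx_mid k (p q : 'M[R]_k) : q *m p \in unitmx ->
  p *m invmx (q *m p) *m q = 1%:M.
Proof.
move=> uqp; have := uqp; rewrite unitmx_mul => /andP[uq _].
apply: (can_inj (mulKmx uq)); rewrite mulmx1 !mulmxA.
by rewrite mulmxV// mul1mx.
Qed.

Lemma range_factor k m (U : 'M[R]_(m, k)) (S : 'M[R]_m) :
  range (fun y : 'cV[R]_k => U *m y) = range (fun y : 'cV[R]_m => S *m y) ->
  exists C, U = S *m C.
Proof.
move=> rU; have colU j : exists y : 'cV[R]_m, S *m y = col j U.
  have : range (fun y : 'cV[R]_k => U *m y) (col j U).
    by exists (delta_mx j 0) => //; rewrite -colE.
  by rewrite rU => -[y _ <-]; exists y.
have [y yE] := choice colU; exists (\matrix_(i, j) y j i 0).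
apply/matrixP => i j; have := yE j => /matrixP/(_ i 0).
rewrite !mxE => <-; apply: eq_bigr => l _; by rewrite !mxE.
Qed.

(** * The whitened matrices, for mixing matrices in canonical form *)

Section eca.
Variables (k d1 d2 d3 : nat).
Variables (O1 : 'M[R]_(d1, k)) (O2 : 'M[R]_(d2, k)) (O3 : 'M[R]_(d3, k)).
Variable g : 'I_k -> R.
Variables (P12 : 'M[R]_(d1, d2)) (P31 : 'M[R]_(d3, d1)) (P32 : 'M[R]_(d3, d2)).
Variable Tr : 'cV[R]_d3 -> 'M[R]_(d1, d2).
Hypothesis P12E : P12 = O1 *m O2^T.
Hypothesis P31E : P31 = O3 *m O1^T.
Hypothesis P32E : P32 = O3 *m O2^T.
Hypothesis TrE : forall eta,
  Tr eta = O1 *m diag_mx (\row_i (g i * (eta^T *m O3) 0 i)) *m O2^T.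
Variables (A : 'M[R]_(k, d1)) (B : 'M[R]_(k, d2)) (U : 'M[R]_(d3, k)) (V : 'M[R]_k).
Hypothesis choices : ECA_choices P12 P31 P32 A B U V.

Let W := U *m V.
Let M := W^T *m O3.

Let tP12E : tPairs12 P12 A B = (A *m O1) *m (B *m O2)^T.
Proof. by rewrite /tPairs12 P12E trmx_mul !mulmxA. Qed.

Let tP31E : tPairs31 P31 A = O3 *m (A *m O1)^T.
Proof. by rewrite /tPairs31 P31E trmx_mul !mulmxA. Qed.

Let tP32E : tPairs32 P32 B = O3 *m (B *m O2)^T.
Proof. by rewrite /tPairs32 P32E trmx_mul !mulmxA. Qed.

Let tP12_unit : (A *m O1) *m (B *m O2)^T \in unitmx.
Proof. by rewrite -tP12E; case: choices. Qed.

Lemma Pairs3_factor : Pairs3 P12 P31 P32 A B = O3 *m O3^T.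
Proof.
rewrite /Pairs3 /tPairs23 tP12E tP31E tP32E.
rewrite (trmx_mul (A *m O1)) (trmx_mul O3) !trmxK.
have uqp : (B *m O2) *m (A *m O1)^T \in unitmx.
  by rewrite -unitmx_tr trmx_mul trmxK.
have E := mulmx_invmx_mid uqp.
set p := (A *m O1)^T in E *; set q := B *m O2 in E *.
have -> : O3 *m p *m invmx (q *m p) *m (q *m O3^T) =
    O3 *m (p *m invmx (q *m p) *m q) *m O3^T by rewrite !mulmxA.
by rewrite E mulmx1.
Qed.

Lemma Triples3_factor eta : Triples3 P12 P31 P32 Tr A B eta =
  O3 *m diag_mx (\row_i (g i * (eta^T *m O3) 0 i)) *m O3^T.
Proof.
have E := mulmx_invmx_mid tP12_unit.
rewrite /Triples3 /tPairs13 /tTriples132 TrE tP12E tP31E tP32E.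
set a := A *m O1 in E *; set b := (B *m O2)^T in E *; set D := diag_mx _.
have -> : A *m (O1 *m D *m O2^T) *m B^T = a *m D *m b.
  by rewrite /a /b trmx_mul !mulmxA.
rewrite trmx_mul trmxK.
have -> : O3 *m b *m invmx (a *m b) *m (a *m D *m b) *m invmx (a *m b) *m (a *m O3^T)
  = O3 *m (b *m invmx (a *m b) *m a) *m D *m (b *m invmx (a *m b) *m a) *m O3^T.
  by rewrite !mulmxA.
by rewrite E !mulmx1.
Qed.

Lemma whitened_orthogonal : M *m M^T = 1%:M.
Proof.
have [_ _ <-] := choices.
by rewrite Pairs3_factor /M /W !trmx_mul !trmxK !mulmxA.
Qed.

(** The range condition gives [W = O3 C'] with [C' = C V] square, and invertibility of
    [M = C'^T O3^T O3] forces that of [C']. Hence [O3 = W C'^-1] lies in the range of [W], where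
    [W W^+] is the identity. *)
Lemma pinv_whitened : (Defs.pinv W)^T *m M = O3.
Proof.
have [C UE] : exists C, U = O3 *m C.
  have [_ /range_factor[C ->] _] := choices.
  by exists (O3^T *m C); rewrite Pairs3_factor mulmxA.
have WE : W = O3 *m (C *m V) by rewrite /W UE mulmxA.
have [uM _] := mulmx1_unit whitened_orthogonal.
have uC : C *m V \in unitmx.
  move: uM; rewrite /M {1}WE trmx_mul -mulmxA unitmx_mul => /andP[+ _].
  by rewrite unitmx_tr.
have WWE : W^T *m W = M *m (C *m V) by rewrite {2}WE mulmxA.
have uWW : W^T *m W \in unitmx by rewrite WWE unitmx_mul uM uC.
have OE : O3 = W *m invmx (C *m V) by rewrite WE -mulmxA mulmxV// mulmx1.
rewrite /Defs.pinv trmx_mul trmxK trmx_inv trmx_mul trmxK.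
have -> : M = W^T *m W *m invmx (C *m V) by rewrite /M {1}OE mulmxA.
by rewrite mulmxA -(mulmxA W) mulVmx// mulmx1 -OE.
Qed.

Lemma whitened_Triples3 theta :
  W^T *m Triples3 P12 P31 P32 Tr A B (W *m theta) *m W =
  M *m diag_mx (\row_i (g i * (theta^T *m M) 0 i)) *m M^T.
Proof.
by rewrite Triples3_factor /M !trmx_mul !trmxK !mulmxA.
Qed.

End eca.

(** * Simple left singular vectors of [M diag(dl) M^T] with [M] orthogonal *)

Section svd.
Variables (n : nat) (M : 'M[R]_n) (dl : 'rV[R]_n).
Hypothesis orthM : M *m M^T = 1%:M.

Let orthM' : M^T *m M = 1%:M.
Proof. exact: mulmx1C. Qed.

Let N := M *m diag_mx dl *m M^T.

(* With [X = M^T L] for an SVD [N = L S Q^T], [N N^T = L S^2 L^T] gives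
   [dl_a^2 X_ab = X_ab s_b^2], so [X] only links indices with [|dl_a| = s_b]. *)
Let simple_left_singular_eigen t u : simple_left_singular N t u ->
  exists a, [/\ `|dl 0 a| = t, forall c, `|dl 0 c| = t -> c = a &
    u = col a M \/ u = - col a M].
Proof.
move=> [L [s [Q [i [[LL QQ s0 NE] -> si sU]]]]].
pose X := M^T *m L.
have LL' := mulmx1C LL.
have XX : X^T *m X = 1%:M.
  by rewrite /X trmx_mul trmxK mulmxA -(mulmxA L^T) orthM mulmx1.
have XX' := mulmx1C XX.
have NN : M *m diag_mx dl *m diag_mx dl *m M^T = L *m diag_mx s *m diag_mx s *m L^T.
  transitivity (N *m N^T).
    by rewrite /N !trmx_mul trmxK tr_diag_mx !mulmxA -(mulmxA _ M^T M) orthM' mulmx1.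
  by rewrite NE !trmx_mul trmxK tr_diag_mx !mulmxA -(mulmxA _ Q^T Q) QQ mulmx1.
have DX : diag_mx dl *m (diag_mx dl *m X) = X *m diag_mx s *m diag_mx s.
  have := congr1 (fun Z => M^T *m Z *m L) NN.
  rewrite !mulmxA orthM' mul1mx -!mulmxA => ->.
  by rewrite LL mulmx1 /X !mulmxA.
have DE (Y : 'M[R]_n) a b : (diag_mx dl *m Y) a b = dl 0 a * Y a b.
  by rewrite mul_diag_mx mxE.
have ED (Y : 'M[R]_n) a b : (Y *m diag_mx s) a b = Y a b * s 0 b.
  by rewrite mul_mx_diag mxE.
have link a b : X a b != 0 -> `|dl 0 a| = s 0 b.
  move=> Xab; have := congr1 (fun Z : 'M[R]_n => Z a b) DX.
  rewrite !DE !ED mulrA -(mulrA (X a b)) [RHS]mulrC => /(mulIf Xab) E.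
  rewrite -[RHS]ger0_norm//; apply/eqP.
  by rewrite -(@eqrXn2 _ 2)// !real_normK ?num_real// !expr2 E.
(* Since [t] occurs only at position [i] of [s], row [c] of the orthogonal matrix [X] is supported
   at [i]. *)
have row1 c : `|dl 0 c| = t -> X c i ^+ 2 = 1.
  move=> ct; have := congr1 (fun Z : 'M[R]_n => Z c c) XX'.
  rewrite mxE [RHS]mxE eqxx (bigD1 i)//= big1 => [|b bi].
    by rewrite addr0 [X^T _ _]mxE expr2.
  rewrite [X^T _ _]mxE; have [->|Xcb] := eqVneq (X c b) 0; first by rewrite mul0r.
  by have := sU b; rewrite -(link c b Xcb) => /(_ ct) be; rewrite be eqxx in bi.
have coli : \sum_c X c i ^+ 2 = 1.
  transitivity ((X^T *m X) i i); last by rewrite XX mxE eqxx.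
  rewrite [RHS]mxE; apply: eq_bigr => c _.
  by rewrite [X^T _ _]mxE expr2.
have [a Xai] : exists a, X a i != 0.
  apply: contrapT => /forallNP X0; have := coli.
  rewrite big1 => [/esym/eqP|c _]; first by rewrite oner_eq0.
  by have /negP := X0 c; rewrite negbK => /eqP ->; rewrite expr0n.
have at_ : `|dl 0 a| = t by rewrite (link a i Xai).
(* Column [i] also has norm 1, and its entry at [a] already exhausts it. *)
have colz c : c != a -> X c i = 0.
  move=> ca; move: coli; rewrite (bigD1 a)//= (row1 a at_).
  move=> /eqP; rewrite -subr_eq0 addrAC subrr add0r => /eqP S0.
  have := psumr_eq0P _ S0 => /(_ (fun c _ => sqr_ge0 _)) /(_ c ca) /eqP.
  by rewrite sqrf_eq0 => /eqP.
exists a; split=> // [c ct|].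
  apply/eqP; apply/negP => /negP ca; have := row1 c ct.
  by rewrite (colz c ca) expr0n /= => /esym/eqP; rewrite oner_eq0.
have LE : col i L = X a i *: col a M.
  rewrite -[L]mul1mx -orthM -mulmxA -/X; apply/matrixP => b e.
  rewrite !mxE (bigD1 a)//= big1 ?addr0 ?mxE 1?mulrC// => c ca.
  by rewrite (colz c ca) mulr0.
have /eqP := row1 a at_; rewrite sqrf_eq1 => /orP[] /eqP Xe.
- by left; rewrite LE Xe scale1r.
- by right; rewrite LE Xe scaleN1r.
Qed.

(** An explicit SVD: the absolute values [|dl_c|] on the diagonal, their signs [sg] moved into the
    right factor, and the sign [e] of [u] put on both orthogonal factors, where it cancels. Setting
    [sg] to 1 at zero entries keeps the right factor orthogonal. *)
Let eigen_simple_left_singular t u a : `|dl 0 a| = t ->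
  (forall c, `|dl 0 c| = t -> c = a) -> u = col a M \/ u = - col a M ->
  simple_left_singular N t u.
Proof.
move=> at_ aU uE.
have [e e2 ->] : exists2 e : R, e * e = 1 & u = e *: col a M.
  case: uE => ->; first by exists 1; rewrite ?mulr1 ?scale1r.
  by exists (-1); rewrite ?mulrNN ?mulr1 ?scaleN1r.
pose sg c : R := if 0 <= dl 0 c then 1 else -1.
have sg2 c : sg c * sg c = 1 by rewrite /sg; case: ifP; rewrite ?mulrNN mulr1.
have sgE c : `|dl 0 c| * sg c = dl 0 c.
  rewrite /sg; case: lerP => [d0|d0]; first by rewrite ger0_norm// mulr1.
  by rewrite ltr0_norm// mulrN1 opprK.
have tZ : (e *: M)^T = e *: M^T by apply/matrixP => ? ?; rewrite !mxE.
exists (e *: M), (\row_c `|dl 0 c|), (M *m diag_mx (\row_c (e * sg c))), a.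
split.
- split.
  + by rewrite tZ -scalemxAl -scalemxAr scalerA e2 scale1r.
  + rewrite trmx_mul tr_diag_mx !mulmxA -(mulmxA _ M^T) orthM' mulmx1.
    rewrite mulmx_diag -diag_const_mx; congr diag_mx; apply/rowP => c.
    by rewrite !mxE mulrACA e2 sg2 mulr1.
  + by move=> c; rewrite mxE.
  + rewrite /N trmx_mul tr_diag_mx mulmxA; congr (_ *m _).
    apply/matrixP => b c; rewrite !mul_mx_diag !mxE.
    transitivity (e * e * (M b c * (`|dl 0 c| * sg c))); last by ring.
    by rewrite e2 mul1r sgE.
- by apply/matrixP => b c; rewrite !mxE.
- by rewrite mxE.
- by move=> c; rewrite mxE => /aU.
Qed.

Lemma simple_left_singularP t u : simple_left_singular N t u <->
  exists a, [/\ `|dl 0 a| = t, forall c, `|dl 0 c| = t -> c = a &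
    u = col a M \/ u = - col a M].
Proof.
split; first exact: simple_left_singular_eigen.
by move=> [a [at_ aU uE]]; exact: eigen_simple_left_singular at_ aU uE.
Qed.

Lemma col_orthogonal_neq a : col a M <> - col a M.
Proof.
move=> /eqP; rewrite -subr_eq0 opprK -mulr2n -scaler_nat scaler_eq0 pnatr_eq0/=.
move=> /eqP M0; have := congr1 (fun Z : 'M[R]_n => Z a a) orthM'.
rewrite !mxE eqxx big1 => [/esym/eqP|c _]; first by rewrite oner_eq0.
by have /matrixP/(_ c 0) := M0; rewrite !mxE => ->; rewrite mulr0.
Qed.

Variable Lam : set 'cV[R]_n.
Hypothesis LamP : simple_left_singular_set N Lam.

(** The value 1 is also the default when neither sign of the column lies in [Lam]. *)
Definition lam_sign a : R := if `[< Lam (- col a M) >] then -1 else 1.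

Lemma lam_sign_signs : signs lam_sign.
Proof. by move=> a; rewrite /lam_sign; case: ifP; [left|right]. Qed.

Lemma simple_left_singular_sub : Lam `<=` [set lam_sign a *: col a M | a in setT].
Proof.
move=> u Lu; have [t /simple_left_singularP[a [at_ aU uE]]] := LamP.1 u Lu.
exists a => //; rewrite /lam_sign; case: asboolP => [La|nLa]; last first.
  by case: uE => uE; [rewrite scale1r uE|case: nLa; rewrite -uE].
rewrite scaleN1r; case: uE => [uE|->//]; exfalso.
have uS : simple_left_singular N t u.
  by apply/simple_left_singularP; exists a; split => //; left.
have mS : simple_left_singular N t (- col a M).
  by apply/simple_left_singularP; exists a; split => //; right.
(* [Lam] would contain both signs for one singular value, against uniqueness, since the column is
   not its own opposite. *)
have [v [_ vU]] := LamP.2 t (ex_intro _ u uS).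
apply: (@col_orthogonal_neq a); rewrite -{1}uE.
by rewrite -(vU u) // -(vU (- col a M)).
Qed.

Lemma simple_left_singular_eq : injective (fun a => `|dl 0 a|) ->
  Lam = [set lam_sign a *: col a M | a in setT].
Proof.
move=> inj; apply/seteqP; split; first exact: simple_left_singular_sub.
move=> _ [a _ <-]; rewrite /lam_sign; case: asboolP => [La|nLa].
  by rewrite scaleN1r.
have aS : simple_left_singular N `|dl 0 a| (col a M).
  by apply/simple_left_singularP; exists a; split => [//|c|]; [exact: inj|left].
have [u [[Lu /simple_left_singularP[c [ca _ uE]]] _]] := LamP.2 _ (ex_intro _ _ aS).
move/inj in ca; subst c; rewrite scale1r.
by case: uE => uE; [rewrite -uE|case: nLa; rewrite -uE].
Qed.

End svd.
End LinearAlgebra.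

(** * Hyperplanes are null for the uniform distribution on the sphere *)

Section UniformSphere.
Context (R : realType) d (T : measurableType d) (P : probability T R) (n : nat).
Variable X : T -> 'cV[R]_n.
Hypothesis unifX : uniform_on_sphere P X.

Local Notation dot u v := ((u^T *m v) 0 0).

Let dotE (u v : 'cV[R]_n) : dot u v = \sum_i u i 0 * v i 0.
Proof. by rewrite mxE; apply: eq_bigr => i _; rewrite mxE. Qed.

Definition hyperplane_event (w : 'cV[R]_n) : set T := [set t | dot w (X t) = 0].

Lemma hyperplane_event_measurable w : measurable (hyperplane_event w).
Proof.
have [mX _ _] := unifX.
have mf : measurable_fun [set: T] (fun t => dot w (X t)).
  under eq_fun do rewrite dotE.
  by apply: measurable_sum => i; apply: measurable_funM; first exact: measurable_cst.
rewrite -[X in measurable X]setTI; exact: mf _ _ (measurable_set1 0).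
Qed.

Lemma hyperplane_borel (w : 'cV[R]_n) : borel_cV [set y | dot w y = 0].
Proof.
pose G := borel_cV (R := R) (n := n).
have GE : <<s G>> = G by apply: sigma_algebra_id; exact: smallest_sigma_algebra.
rewrite -[X in X _]/G -GE.
have mf : measurable_fun [set: g_sigma_algebraType G] (fun y : 'cV[R]_n => dot w y).
  under eq_fun do rewrite dotE.
  apply: measurable_sum => i; apply: measurable_funM; first exact: measurable_cst.
  move=> _ B mB; apply: sub_sigma_algebra; apply: sub_sigma_algebra.
  by rewrite (bigD1 i)//=; left; exists B.
by have := mf measurableT _ (measurable_set1 0); rewrite setTI.
Qed.

Let dotZl c (u v : 'cV[R]_n) : dot (c *: u) v = c * dot u v.
Proof.
by rewrite !dotE big_distrr/=; apply: eq_bigr => i _; rewrite mxE mulrA.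
Qed.

Let dotC (u v : 'cV[R]_n) : dot u v = dot v u.
Proof. by rewrite !dotE; apply: eq_bigr => i _; rewrite mulrC. Qed.

Let dotBl (u v w : 'cV[R]_n) : dot (u - v) w = dot u w - dot v w.
Proof.
by rewrite !dotE -sumrB; apply: eq_bigr => i _; rewrite !mxE mulrBl.
Qed.

Let dot_eq0 (w : 'cV[R]_n) : dot w w = 0 -> w = 0.
Proof.
rewrite dotE => S0; apply/matrixP => i j; rewrite (ord1 j) mxE.
have := psumr_eq0P _ S0 => /(_ (fun i _ => sqr_ge0 (w i 0))) /(_ i isT) /eqP.
by rewrite mulf_eq0 orbb => /eqP.
Qed.

(* The Householder reflection exchanging [w] and [w']. *)
Lemma hyperplane_event_reflect (w w' : 'cV[R]_n) : dot w w = dot w' w' ->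
  P (hyperplane_event w) = P (hyperplane_event w').
Proof.
move=> ww'; pose v := w - w'.
have [v0|v0] := eqVneq (dot v v) 0.
  suff -> : w = w' by [].
  by apply/eqP; rewrite -subr_eq0; apply/eqP/dot_eq0.
pose c := 2 / dot v v; pose S := v *m v^T.
have SE u : S *m u = dot v u *: v.
  by rewrite /S -mulmxA [X in _ *m X = _]mx11_scalar mul_mx_scalar.
have SS : S *m S = dot v v *: S.
  by rewrite {2}/S mulmxA SE -scalemxAl.
pose Q : 'M[R]_n := 1%:M - c *: S.
have QT : Q^T = Q.
  by apply/matrixP => i j; rewrite !mxE eq_sym; congr (_ - c * _);
     apply: eq_bigr => l _; rewrite !mxE mulrC.
have cv : c * dot v v = 2 by rewrite /c divfK.
have QQ : Q^T *m Q = 1%:M.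
  rewrite QT {1}/Q mulmxBl mul1mx -scalemxAl {2}/Q mulmxBr mulmx1 -scalemxAr SS.
  rewrite !scalerA cv scalerBr scalerA (_ : c * 2 = c + c); last by ring.
  rewrite -scalerBl (_ : c - (c + c) = - c); last by ring.
  by rewrite scaleNr opprK /Q subrK.
(* Equality of norms enters here; it makes [Q w = w - v = w']. *)
have vw : 2 * dot v w = dot v v.
  rewrite {2}/v dotBl (dotC w v) (dotC w' v) /v !dotBl -ww' (dotC w' w); ring.
have Qw : Q *m w = w'.
  rewrite /Q mulmxBl mul1mx -scalemxAl SE scalerA.
  have -> : c * dot v w = 1 by rewrite /c mulrAC vw divff.
  by rewrite scale1r /v opprB addrC subrK.
have [_ _ /(_ Q QQ _ (hyperplane_borel w)) <-] := unifX.
congr (P _); apply/seteqP; split => t; rewrite /hyperplane_event /= mulmxA;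
  by rewrite -{1}QT -trmx_mul Qw.
Qed.

Lemma hyperplane_event_scale (w : 'cV[R]_n) c : c != 0 ->
  hyperplane_event (c *: w) = hyperplane_event w.
Proof.
move=> c0; apply/seteqP; split => t; rewrite /hyperplane_event /= dotZl.
  by move/eqP; rewrite mulf_eq0 (negbTE c0) => /eqP.
by move=> ->; rewrite mulr0.
Qed.

Let dot_gt0 (w : 'cV[R]_n) : w != 0 -> 0 < dot w w.
Proof.
move=> w0; rewrite lt_neqAle eq_sym; apply/andP; split; last first.
  by rewrite dotE sumr_ge0// => i _; exact: sqr_ge0.
by apply: contra w0 => /eqP/dot_eq0 ->.
Qed.

Lemma hyperplane_event_prob (w w' : 'cV[R]_n) : w != 0 -> w' != 0 ->
  P (hyperplane_event w) = P (hyperplane_event w').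
Proof.
move=> /dot_gt0 w0 /dot_gt0 w0'.
(* Chosen so that [c w'] has the norm of [w]; scaling leaves the hyperplane unchanged. *)
pose c := Num.sqrt (dot w w / dot w' w').
have c0 : c != 0 by rewrite gt_eqF// sqrtr_gt0 divr_gt0.
rewrite -(hyperplane_event_scale w' c0); apply: hyperplane_event_reflect.
rewrite dotZl dotC dotZl mulrA -expr2 /c sqr_sqrtr ?divfK ?gt_eqF//.
by rewrite divr_ge0// ltW.
Qed.

Definition moment_point (t : nat) : 'cV[R]_n := \col_j t%:R ^+ j.

(* The moment curve meets a hyperplane in the roots of a polynomial. *)
Lemma moment_hyperplanes_le N (y : 'cV[R]_n) : y != 0 ->
  (\sum_(t < N) (dot (moment_point t) y == 0%R) <= n)%N.
Proof.
move=> y0; pose p := \poly_(j < n) (if insub j is Some j' then y j' 0 else 0).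
have yE (i : 'I_n) : (if insub (val i) is Some j' then y j' 0 else 0) = y i 0.
  by rewrite insubT//= => ?; congr (y _ _); exact: val_inj.
have pE (i : 'I_n) : p`_i = y i 0 by rewrite coef_poly ltn_ord yE.
have p0 : p != 0.
  apply: contra y0 => /eqP p0; apply/eqP/matrixP => i j.
  by rewrite (ord1 j) mxE -pE p0 coef0.
have horner_p t : p.[t%:R] = dot (moment_point t) y.
  rewrite dotE horner_poly; apply: eq_bigr => i _.
  by rewrite mxE mulrC yE.
pose rs : seq R := map (fun t : 'I_N => t%:R)
  (seq.filter (fun t : 'I_N => dot (moment_point t) y == 0) (enum 'I_N)).
have rs_root : all (root p) rs.
  apply/allP => _ /mapP[t + ->]; rewrite mem_filter => /andP[/eqP t0 _].
  by rewrite /root horner_p t0.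
have rs_uniq : uniq rs.
  rewrite map_inj_uniq; first exact: filter_uniq (enum_uniq _).
  by move=> t t' /eqP; rewrite eqr_nat => /eqP /val_inj.
have := max_poly_roots p0 rs_root rs_uniq; rewrite size_map size_filter.
rewrite -sum1_count big_enum_cond/= -big_mkcond/= => /ltnW /leq_trans; apply.
exact: size_poly.
Qed.

(* The hyperplanes normal to points of the moment curve are equiprobable, and
   at most [n] of them contain a given nonzero vector. *)
Lemma hyperplane_event_null (w : 'cV[R]_n) : w != 0 -> P (hyperplane_event w) = 0%E.
Proof.
move=> w0; have n0 : (0 < n)%N.
  rewrite lt0n; apply: contra w0 => /eqP n0; apply/eqP/matrixP => i.
  by have := ltn_ord i; rewrite {2}n0.
(* The first coordinate is [t^0 = 1], also at [t = 0]. *)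
have mpt0 t : moment_point t != 0.
  apply/eqP => /matrixP/(_ (Ordinal n0) 0); rewrite !mxE expr0 => /eqP.
  by rewrite oner_eq0.
pose p := fine (P (hyperplane_event w)).
have mH t : measurable (hyperplane_event (moment_point t)).
  exact: hyperplane_event_measurable.
(* The left side is the expected number of the first [N] hyperplanes that contain [X]. Almost surely
   [X] has norm 1, hence is nonzero, and this number is at most [n]. *)
have bound N : N%:R * p <= n%:R.
  have iH (t : 'I_N) := integrable_indic P (mH t).
  have [iS SE] := integrable_lincomb (index_enum 'I_N) (fun=> 1) measurableT iH.
  have <- : \int[P]_t (\sum_(i < N) 1 * \1_(hyperplane_event (moment_point i)) t)
      = N%:R * p.
    rewrite SE -[in RHS](card_ord N) -sum1_card natr_sum big_distrl/=.
    apply: eq_bigr => t _; congr (_ * _).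
    rewrite /Rintegral integral_indic// setIT.
    exact: (congr1 fine (hyperplane_event_prob (mpt0 t) w0)).
  rewrite -lee_fin fineK; last exact: integrable_fin_num iS.
  have -> : (n%:R%:E = \int[P]_t (cst n%:R%:E) t)%E.
    rewrite integral_cst// -[LHS]mule1; congr (_ * _)%E.
    exact/esym/probability_setT.
  have [mX X1 _] := unifX.
  apply: ae_ge0_le_integral => //.
  - by move=> t _; rewrite lee_fin sumr_ge0// => i _; rewrite mul1r.
  - exact: measurable_int iS.
  - by move=> t _; rewrite lee_fin.
  - apply: filterS X1 => t Xt _; rewrite lee_fin.
    rewrite (eq_bigr (fun i : 'I_N => (dot (moment_point i) (X t) == 0)%:R)).
      rewrite -natr_sum ler_nat; apply: moment_hyperplanes_le.
      apply/eqP => Xt0; have := congr1 (fun Z : 'M[R]_1 => Z 0 0) Xt.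
      by rewrite Xt0 mulmx0 !mxE eqxx => /esym/eqP; rewrite oner_eq0.
    move=> i _; rewrite mul1r indicE; congr (nat_of_bool _)%:R.
    by apply/idP/eqP; rewrite inE.
have p0 : 0 <= p by exact: fine_ge0.
have : p = 0.
  apply/eqP; rewrite eq_le p0 andbT leNgt; apply/negP => pp.
  have := bound (Num.truncn (n%:R / p)).+1.
  by rewrite leNgt -ltr_pdivrMr// truncnS_gt.
move=> pz; rewrite -[LHS]fineK; first by rewrite -/p pz.
by rewrite fin_num_measure//; exact: hyperplane_event_measurable.
Qed.

End UniformSphere.

(** * The procedure in canonical form *)

Section Canonical.
Context (R : realType) (dsp : measure_display) (T : measurableType dsp).
Context (P : probability T R) (k : nat) (h : T -> 'cV[R]_k) (dim : 'I_3 -> nat).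
Context (x : forall v : 'I_3, T -> 'cV[R]_(dim v)).
Context (O : forall v : 'I_3, 'M[R]_(dim v, k)).
Hypothesis model : multiview_model P h x O.

Definition canonical_mx v : 'M[R]_(dim v, k) :=
  O v *m diag_mx (\row_i std_dev P h i).

Let std_dev_gt0 i : 0 < std_dev P h i.
Proof. by rewrite sqrtr_gt0; exact: factors_var_gt0 model i. Qed.

Let std_dev2 i : std_dev P h i ^+ 2 = central_moment P h i 2.
Proof. by rewrite sqr_sqrtr// ltW//; exact: factors_var_gt0 model i. Qed.

Lemma Pairs_canonical v v' : v != v' ->
  Pairs P x v v' = canonical_mx v *m (canonical_mx v')^T.
Proof.
move=> vv'; rewrite (PairsE model vv') /canonical_mx trmx_mul tr_diag_mx.
rewrite !mulmxA -(mulmxA _ (diag_mx _) (diag_mx _)) mulmx_diag.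
congr (_ *m diag_mx _ *m _); apply/rowP => i.
by rewrite !mxE -expr2 std_dev2.
Qed.

(** Since [mu_{i,3} = gamma_i sigma_i^3], each of the three canonical matrices absorbs one factor
    [sigma_i]. *)
Lemma Triples_canonical eta : Triples132 P x eta =
  canonical_mx view1 *m
  diag_mx (\row_i (skewness P h i * (eta^T *m canonical_mx view3) 0 i)) *m
  (canonical_mx view2)^T.
Proof.
rewrite (Triples132E model) /canonical_mx trmx_mul tr_diag_mx !mulmxA.
rewrite -(mulmxA _ (diag_mx _) (diag_mx _)) mulmx_diag.
rewrite -(mulmxA _ (diag_mx _) (diag_mx _)) mulmx_diag.
congr (_ *m diag_mx _ *m _); apply/rowP => i.
rewrite mul_mx_diag !mxE /skewness.
have := std_dev_gt0 i; set s := std_dev P h i => s0.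
by field; rewrite gt_eqF.
Qed.

Lemma col_canonical i :
  col i (canonical_mx view3) = std_dev P h i *: col i (O view3).
Proof.
by apply/matrixP => a b; rewrite /canonical_mx mul_mx_diag !mxE mulrC.
Qed.

Section choices.
Variables (A : 'M[R]_(k, dim view1)) (B : 'M[R]_(k, dim view2)).
Variables (U : 'M[R]_(dim view3, k)) (V : 'M[R]_k).
Hypothesis choices : ECA_choices (Pairs P x view1 view2) (Pairs P x view3 view1)
  (Pairs P x view3 view2) A B U V.

Definition whitened_mx : 'M[R]_k := (U *m V)^T *m canonical_mx view3.

Definition whitened_spectrum (theta : 'cV[R]_k) : 'rV[R]_k :=
  \row_i (skewness P h i * (theta^T *m whitened_mx) 0 i).

Let P12 : Pairs P x view1 view2 = _ := @Pairs_canonical view1 view2 isT.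
Let P31 : Pairs P x view3 view1 = _ := @Pairs_canonical view3 view1 isT.
Let P32 : Pairs P x view3 view2 = _ := @Pairs_canonical view3 view2 isT.

Lemma whitened_mx_orthogonal : whitened_mx *m whitened_mx^T = 1%:M.
Proof. exact: (whitened_orthogonal P12 P31 P32 choices). Qed.

Lemma output_whitened theta Ohat :
  ECA_output (Pairs P x view1 view2) (Pairs P x view3 view1)
    (Pairs P x view3 view2) (Triples132 P x) A B U V theta Ohat ->
  exists2 Lam, simple_left_singular_set
      (whitened_mx *m diag_mx (whitened_spectrum theta) *m whitened_mx^T) Lam &
    Ohat = [set (Defs.pinv (U *m V))^T *m l | l in Lam].
Proof.
move=> [Lam LamP OE]; exists Lam => //; move: LamP.
by rewrite (whitened_Triples3 P12 P31 P32 Triples_canonical choices).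
Qed.

Lemma image_signed_columns s :
  [set (Defs.pinv (U *m V))^T *m l |
    l in [set s i *: col i whitened_mx | i in [set: 'I_k]]] =
  canonical_columns P h O s.
Proof.
have pE i : (Defs.pinv (U *m V))^T *m (s i *: col i whitened_mx) =
    s i *: (std_dev P h i *: col i (O view3)).
  rewrite -scalemxAr -col_canonical colE mulmxA.
  by rewrite (pinv_whitened P12 P31 P32 choices) -colE.
apply/seteqP; split => y.
  by move=> [_ [i _ <-] <-]; exists i.
by move=> [i _ <-]; exists (s i *: col i whitened_mx) => //; exists i.
Qed.

Lemma whitened_spectrum_inj d' (T' : measurableType d') (P' : probability T' R)
    (theta : T' -> 'cV[R]_k) :
  (forall i, skewness P h i != 0) -> uniform_on_sphere P' theta ->
  {ae P', forall t, injective (fun i => `|whitened_spectrum (theta t) 0 i|)}.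
Proof.
move=> g0 unif.
have MM := mulmx1C whitened_mx_orthogonal.
have Mcol l : whitened_mx^T *m col l whitened_mx = delta_mx l 0.
  by rewrite colE mulmxA MM mul1mx.
have main i j (e : R) : i != j -> {ae P', forall t,
    whitened_spectrum (theta t) 0 i != e * whitened_spectrum (theta t) 0 j}.
  (* Entry [i] of the spectrum minus [e] times entry [j] is [<w, theta>]. The columns being
     orthonormal, coordinate [i] of [M^T w] is [gamma_i], so [w] is nonzero. *)
  move=> ij; pose w := skewness P h i *: col i whitened_mx -
    (e * skewness P h j) *: col j whitened_mx.
  have w0 : w != 0.
    apply/eqP => w0; have := congr1 (fun y => (whitened_mx^T *m y) i 0) w0.
    rewrite mulmx0 /w mulmxBr -!scalemxAr !Mcol !mxE eqxx.
    rewrite (negbTE ij) /= mulr1 mulr0 subr0 => /eqP.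
    by rewrite (negbTE (g0 i)).
  exists (hyperplane_event theta w); split.
  - exact: hyperplane_event_measurable unif w.
  - exact: hyperplane_event_null unif w w0.
  - move=> t /= /negP; rewrite negbK => /eqP E; rewrite /hyperplane_event /=.
    have dotM l : ((theta t)^T *m col l whitened_mx) 0 0 =
        ((theta t)^T *m whitened_mx) 0 l.
      by rewrite colE mulmxA -colE mxE.
    have scaleE c (Y : 'M[R]_1) : (c *: Y) 0 0 = c * Y 0 0 by rewrite mxE.
    have subE (Y Z : 'M[R]_1) : (Y - Z) 0 0 = Y 0 0 - Z 0 0 by rewrite !mxE.
    move: E; rewrite [X in X = _]mxE [X in _ = _ * X]mxE => E.
    rewrite -[w^T *m theta t]trmxK trmx_mul trmxK mxE /w mulmxBr -!scalemxAr.
    by rewrite subE !scaleE !dotM E mulrA subrr.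
have pairs : {ae P', forall t, forall ij : 'I_k * 'I_k, ij.1 != ij.2 ->
    `|whitened_spectrum (theta t) 0 ij.1| != `|whitened_spectrum (theta t) 0 ij.2|}.
  apply: ae_forall_fin => -[i j] /=.
  have [->|ij] := eqVneq i j; first by apply: aeW => t /negP.
  apply: filterS2 (main i j 1 ij) (main i j (-1) ij) => t; rewrite mul1r mulN1r => n1 n2 _.
  apply/eqP => E; have : whitened_spectrum (theta t) 0 i ^+ 2 ==
      whitened_spectrum (theta t) 0 j ^+ 2.
    by rewrite -[X in X == _]real_normK ?num_real// E real_normK ?num_real.
  by rewrite eqf_sqr (negbTE n1) (negbTE n2).
apply: filterS pairs => t H i j E; apply/eqP/negPn/negP => ij.
by have := H (i, j) ij; rewrite /= E eqxx.
Qed.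

End choices.
End Canonical.

Theorem theorem4p4 (R : realType) (dsp : measure_display)
    (T : measurableType dsp) (P : probability T R) (k : nat)
    (h : T -> 'cV[R]_k) (dim : 'I_3 -> nat)
    (x : forall v : 'I_3, T -> 'cV[R]_(dim v))
    (O : forall v : 'I_3, 'M[R]_(dim v, k))
    (model : multiview_model P h x O) :
  let choices := ECA_choices (Pairs P x view1 view2) (Pairs P x view3 view1)
                   (Pairs P x view3 view2) in
  let output := ECA_output (Pairs P x view1 view2) (Pairs P x view3 view1)
                  (Pairs P x view3 view2) (Triples132 P x) in
  (forall (theta : 'cV[R]_k) (A : 'M[R]_(k, dim view1))
      (B : 'M[R]_(k, dim view2)) (U : 'M[R]_(dim view3, k)) (V : 'M[R]_k)
      (Ohat : set 'cV[R]_(dim view3)),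
    choices A B U V -> output A B U V theta Ohat ->
    exists2 s : 'I_k -> R, signs s & Ohat `<=` canonical_columns P h O s)
  /\
  ((forall i : 'I_k, skewness P h i != 0) ->
   forall (dsp' : measure_display) (T' : measurableType dsp')
      (P' : probability T' R) (theta : T' -> 'cV[R]_k),
    uniform_on_sphere P' theta ->
   forall (A : 'M[R]_(k, dim view1)) (B : 'M[R]_(k, dim view2))
      (U : 'M[R]_(dim view3, k)) (V : 'M[R]_k),
    choices A B U V ->
    {ae P', forall w, forall Ohat : set 'cV[R]_(dim view3),
      output A B U V (theta w) Ohat ->
      exists2 s : 'I_k -> R, signs s & Ohat = canonical_columns P h O s}).
Proof.
move=> choices output; split.
- move=> theta A B U V Ohat cABUV /(output_whitened model cABUV)[Lam LamP ->].
  have MM := whitened_mx_orthogonal model cABUV.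
  exists (lam_sign (whitened_mx P h O U V) Lam); first exact: lam_sign_signs.
  rewrite -(image_signed_columns model cABUV).
  exact/image_subset/(simple_left_singular_sub MM LamP).
- move=> g0 dsp' T' P' theta unif A B U V cABUV.
  (* The exceptional null set is fixed before [Ohat], so it serves every sign choice in the output;
     the signs themselves are read off from [Lam]. *)
  apply: filterS (whitened_spectrum_inj model cABUV g0 unif) => t inj Ohat.
  move=> /(output_whitened model cABUV)[Lam LamP ->].
  have MM := whitened_mx_orthogonal model cABUV.
  exists (lam_sign (whitened_mx P h O U V) Lam); first exact: lam_sign_signs.
  by rewrite -(image_signed_columns model cABUV) -(simple_left_singular_eq MM LamP inj).
Qed.
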